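(* Let $w\in\mathbb{N}$ and let $(a_j)_{j\in\mathbb{Z}}$ be complex numbers with $a_j=0$ for $|j|>w$. For $M>1$ let $A=A_M:=[a_{i-j}]_{i,j=1}^M$ be the banded Toeplitz matrix, with band-width $w_M\le w$, and let $A^+_\infty:=[a_{i-j}]_{i,j\in\mathbb{N}}$, a bounded operator on $\ell^2(\mathbb{N})$. Suppose $A$ is written in block form $A=[a_{ij}]_{i,j=1}^N$ with blocks $a_{ij}\in\mathbb{C}^{m_i\times m_j}$, $\sum_{i=1}^Nm_i=M$, $N>1$, and $m_i\ge w_M$ for $i=1,\ldots,N$. Suppose $\varepsilon>0$. Then: (i) $\mathrm{Spec}_\varepsilon A\to\mathrm{Spec}_\varepsilon A^+_\infty$ in the Hausdorff distance as $M\to\infty$; (ii) $\Sigma^n_\varepsilon(A)\to\mathrm{Spec}_\varepsilon A^+_\infty$ in the Hausdorff distance as $n\to\infty$ (with $M\ge w_MN$ and $N>n$); (iii) consequently $d_H(\Sigma^n_\varepsilon(A),\mathrm{Spec}_\varepsilon A)\to0$ as $M,n\to\infty$. If $a_{-j}=\overline{a_j}$ for all $j\in\mathbb{Z}$, then these results hold also for $\varepsilon=0$; in particular $d_H(\Sigma^n_0(A),\mathrm{Spec}\,A)\to0$ as $M,n\to\infty$. (Here the limits in (ii) and (iii) are over all admissible $n,N,M$ and block sizes $m_i$ with $N>n$; i.e. for every $\delta>0$ there is $n_0$ such that the distance is $<\delta$ for all such data with $n\ge n_0$.)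
   Context: All norms are (spectral) $2$-norms/operator norms. For a square matrix or bounded operator $E$ on a Hilbert space and $\varepsilon\ge0$, $\mathrm{Spec}_\varepsilon E:=\{\lambda\in\mathbb{C}:\|(E-\lambda I)^{-1}\|^{-1}\le\varepsilon\}$, with $\|(E-\lambda I)^{-1}\|^{-1}:=0$ if $E-\lambda I$ is not invertible; $\mathrm{Spec}_0E=\mathrm{Spec}\,E$ is the spectrum. A matrix has band-width $v$ if its $(i,j)$ entries vanish for $|i-j|>v$. The Hausdorff distance between compact $T_1,T_2\subset\mathbb{C}$ is $d_H(T_1,T_2):=\max\{\sup_{t_1\in T_1}\mathrm{dist}(t_1,T_2),\sup_{t_2\in T_2}\mathrm{dist}(t_2,T_1)\}$. Since $m_i\ge w_M$, the block matrix $A=[a_{ij}]_{i,j=1}^N$ is block-tridiagonal. (The double-indexed $a_{ij}$ are blocks; the single-indexed $a_j$ are the Toeplitz coefficients.) Put $r_L(A):=\max_{1\le i\le N-1}\|a_{i+1,i}\|$, $r_U(A):=\max_{1\le i\le N-1}\|a_{i,i+1}\|$, $r(A):=r_L(A)+r_U(A)$. For $n\in\mathbb{N}$, $\varepsilon_n(A):=2r(A)\sin(\theta_n(A)/2)$, where $\theta_n(A)$ is the unique solution $t\in\left[\frac{\pi}{2n+1},\frac{\pi}{n+2}\right]$ of $$2\sin\Big(\frac t2\Big)\cos\Big(\Big(n+\frac12\Big)t\Big)+\frac{r_L(A)r_U(A)}{(r(A))^2}\sin((n-1)t)=0$$ (if $r(A)=0$ then $\varepsilon_n(A):=0$). For $1\le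 n\le N$ and $0\le k\le N-n$ put $M_{n,k}:=\sum_{i=k+1}^{k+n}m_i$, so that the block submatrix $[a_{ij}]_{i,j=k+1}^{k+n}$ equals the Toeplitz matrix $A_{M_{n,k}}$ (where $A_1:=(a_0)$). For $\varepsilon\ge0$ and $1\le n\le N-1$, $$\sigma^n_\varepsilon(A):=\bigcup_{k=0}^{N-n}\mathrm{Spec}_{\varepsilon+\varepsilon_n(A)}A_{M_{n,k}}\cup\bigcup_{m=1}^{n-1}\left(\mathrm{Spec}_{\varepsilon+\varepsilon_n(A)}A_{M_{m,0}}\cup\mathrm{Spec}_{\varepsilon+\varepsilon_n(A)}A_{M_{m,N-m}}\right),$$ for $n\ge3$, $\widehat\sigma^n_\varepsilon(A):=\bigcup_{k=0}^{N-n}\mathrm{Spec}_{\varepsilon+\varepsilon_{n-2}(A)}A_{M_{n,k}}$, and $\Sigma^n_\varepsilon(A):=\sigma^n_\varepsilon(A)$ for $n=1,2$, $\Sigma^n_\varepsilon(A):=\sigma^n_\varepsilon(A)\cap\widehat\sigma^n_\varepsilon(A)$ for $n>2$. *)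

(* Defs.v *)
From HB Require Import structures.
From mathcomp Require Import all_boot all_order all_algebra.
From mathcomp Require Import complex.
From mathcomp Require Import all_classical all_reals all_analysis.

Set Implicit Arguments.
Unset Strict Implicit.
Unset Printing Implicit Defensive.

Import Order.TTheory GRing.Theory Num.Theory.
Import numFieldNormedType.Exports.
Import Normc.

Local Open Scope classical_set_scope.
Local Open Scope ring_scope.
Local Open Scope complex_scope.

Section MatrixNorm.
Context {R : realType}.

Definition norm2 n (x : 'cV[R[i]]_n) : R :=
  Num.sqrt (\sum_(i < n) normc (x i 0) ^+ 2).

Definition mxopnorm m n (A : 'M[R[i]]_(m, n)) : R :=
  sup [set norm2 (A *m x) | x in [set x : 'cV[R[i]]_n | norm2 x <= 1]].

(* ||E^-1||^-1, with value 0 when E is not invertible. *)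
Definition mx_invnormV n (E : 'M[R[i]]_n) : R :=
  if E \in unitmx then (mxopnorm (invmx E))^-1 else 0.

Definition mx_pspec (eps : R) n (E : 'M[R[i]]_n) : set R[i] :=
  [set l | mx_invnormV (E - l%:M) <= eps].

Definition mx_spec n (E : 'M[R[i]]_n) : set R[i] :=
  [set l | E - l%:M \notin unitmx].

Definition has_bandwidth (v : nat) n (A : 'M[R[i]]_n) : Prop :=
  forall i j : 'I_n, (v < `|i%:Z - j%:Z|)%N -> A i j = 0.

End MatrixNorm.

(* Operators on l^2(N) are functions on all complex sequences of which only
   the restriction to l^2 is ever used. *)
Section SequenceSpace.
Context {R : realType}.
Implicit Types (x y : nat -> R[i]) (T B : (nat -> R[i]) -> nat -> R[i]).

Definition in_l2 x : Prop := cvgn (series (fun k => normc (x k) ^+ 2)).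

Definition l2norm x : R :=
  Num.sqrt (limn (series (fun k => normc (x k) ^+ 2))).

Definition l2_bounded_op T : Prop :=
  [/\ forall x, in_l2 x -> in_l2 (T x),
      forall (c : R[i]) x y, in_l2 x -> in_l2 y ->
        T (fun k => c * x k + y k) = (fun k => c * T x k + T y k) &
      exists K : R, forall x, in_l2 x -> l2norm (T x) <= K * l2norm x].

Definition l2_opnorm T : R :=
  sup [set l2norm (T x) | x in [set x | in_l2 x /\ l2norm x <= 1]].

Definition l2_inverse T B : Prop :=
  l2_bounded_op B /\ forall x, in_l2 x -> B (T x) = x /\ T (B x) = x.

(* ||T^-1||^-1, with value 0 when T is not boundedly invertible on l^2. *)
Definition l2_invnormV T : R :=
  match pselect (exists B, l2_inverse T B) with
  | left invT => (l2_opnorm (projT1 (cid invT)))^-1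
  | right _ => 0
  end.

Definition l2_pspec (eps : R) T : set R[i] :=
  [set l | l2_invnormV (fun x k => T x k - l * x k) <= eps].

End SequenceSpace.

(* Extended-real valued, so that an empty or unbounded argument cannot produce
   a spurious finite distance. *)
Section Hausdorff.
Context {R : realType}.

Definition cdist (z : R[i]) (S : set R[i]) : \bar R :=
  ereal_inf [set (normc (z - s))%:E | s in S].

Definition hausdorff (S T : set R[i]) : \bar R :=
  Order.max (ereal_sup [set cdist s T | s in S])
            (ereal_sup [set cdist t S | t in T]).

End Hausdorff.

Section Toeplitz.
Context {R : realType}.
Implicit Types (a : int -> R[i]) (w : nat).

Definition toeplitz a (M : nat) : 'M[R[i]]_M :=
  \matrix_(i < M, j < M) a (i%:Z - j%:Z).

(* For a supported in [-w, w], every term of sum_j a_(i-j) x_j with j > i + w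
   vanishes, so the finite sum below is the full matrix-vector product. *)
Definition toeplitz_op a w (x : nat -> R[i]) : nat -> R[i] :=
  fun i => \sum_(j < i + w.+1) a (i%:Z - j%:Z) * x j.

End Toeplitz.

Section Blocks.
Context {R : realType}.

Section BlockNorms.
Variables (N : nat) (m : 'I_N -> nat) (A : 'M[R[i]]_(\sum_i m i)).

Definition rL : R :=
  \big[Num.max/0]_(p : 'I_N * 'I_N | p.1 == p.2.+1 :> nat)
    mxopnorm (submxblock A p.1 p.2).

Definition rU : R :=
  \big[Num.max/0]_(p : 'I_N * 'I_N | p.2 == p.1.+1 :> nat)
    mxopnorm (submxblock A p.1 p.2).

Definition rLU : R := rL + rU.

Definition theta (n : nat) : R :=
  xget 0 [set t : R |
    (pi / (2 * n%:R + 1) <= t <= pi / (n%:R + 2)) /\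
    2 * sin (t / 2) * cos ((n%:R + 2^-1) * t)
      + rL * rU / rLU ^+ 2 * sin ((n%:R - 1) * t) = 0].

Definition eps_block (n : nat) : R :=
  if rLU == 0 then 0 else 2 * rLU * sin (theta n / 2).

End BlockNorms.

Section Inclusion.
Variables (a : int -> R[i]) (N : nat) (m : 'I_N -> nat).

(* The size of the n consecutive diagonal blocks with 0-based indices
   k, ..., k + n - 1. *)
Definition Msize (n k : nat) : nat := \sum_(i < N | (k <= i < k + n)%N) m i.

Let A := toeplitz a (\sum_i m i).

Definition sigma (n : nat) (eps : R) : set R[i] :=
  let e := eps + eps_block A n in
  (\bigcup_(k in [set k | (k <= N - n)%N])
      mx_pspec e (toeplitz a (Msize n k)))
  `|` \bigcup_(l in [set l | (1 <= l <= n - 1)%N])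
      (mx_pspec e (toeplitz a (Msize l 0))
       `|` mx_pspec e (toeplitz a (Msize l (N - l)))).

Definition sigma_hat (n : nat) (eps : R) : set R[i] :=
  \bigcup_(k in [set k | (k <= N - n)%N])
    mx_pspec (eps + eps_block A (n - 2)) (toeplitz a (Msize n k)).

Definition Sigma (n : nat) (eps : R) : set R[i] :=
  if (n <= 2)%N then sigma n eps else sigma n eps `&` sigma_hat n eps.

End Inclusion.

(* wM ranges over every band-width of A_M not exceeding w. *)
Definition admissible (a : int -> R[i]) (w n N : nat) (m : 'I_N -> nat)
    : Prop :=
  [/\ (1 < N)%N, (0 < n < N)%N, (forall i, (0 < m i)%N) &
      exists wM : nat,
        [/\ (wM <= w)%N, has_bandwidth wM (toeplitz a (\sum_i m i)) &
            forall i, (wM <= m i)%N]].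

(* d n N m -> 0 as n -> oo, uniformly over all admissible block data. *)
Definition admissible_cvg0 (a : int -> R[i]) (w : nat)
    (d : forall n N : nat, ('I_N -> nat) -> \bar R) : Prop :=
  forall delta : R, 0 < delta ->
    exists n0 : nat, forall (n N : nat) (m : 'I_N -> nat),
      admissible a w n m -> (n0 <= n)%N -> (d n N m < delta%:E)%E.

End Blocks.

(* Main.v *)
Require Import Defs.
From HB Require Import structures.
From mathcomp Require Import all_boot all_order all_algebra.
From mathcomp Require Import complex ring lra zify.
From mathcomp Require Import all_classical all_reals all_analysis.

Set Implicit Arguments.
Unset Strict Implicit.
Unset Printing Implicit Defensive.

Import Order.TTheory GRing.Theory Num.Theory.
Import numFieldNormedType.Exports.
Import Normc.

Local Open Scope classical_set_scope.
Local Open Scope ring_scope.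
Local Open Scope complex_scope.

(** Write [T] for the semi-infinite Toeplitz operator and [A_M] for its [M]-th
    section.  Everything rests on comparing, for a complex number [l], lower
    bounds [k * norm2 x <= norm2 ((A_M - l) x)] with the corresponding lower
    bounds for [T - l] and its transpose.

    If [l] is outside the pseudospectrum of [T], then [T - l] and its transpose
    are bounded below by some [k > eps].  In a long vector some window of two
    band-widths carries little mass; removing it decouples the two ends, one of
    which is acted upon by [T - l] and the other, read backwards, by the
    transpose.  Hence [A_M - l] is bounded below by nearly [k] for all large [M]
    ([finite_section_below]), uniformly on bounded sets of [l] by compactness.
    So pseudospectra of large sections, even at a level slightly above [eps],
    lie close to that of [T] ([sections_upper]).

    Conversely, suppose that infinitely many sections have no point of their
    pseudospectrum in a fixed disc around [l].  Then all these [A_M - l] are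
    bounded below by one constant [k > eps] ([section_gap]).  For [eps > 0] this
    is a quantitative maximum principle for the resolvent, with constants that
    depend on the size of the matrix only through its norm
    ([resolvent_growth]); for Hermitian coefficients and [eps = 0] it is the
    spectral theorem ([normal_below]).  Entrywise limits of solutions of the
    sections then invert [T - l] with the same constant ([op_invnormV_ge]), so
    [l] is not in the pseudospectrum of [T].  This gives the other half of the
    convergence ([sections_lower]).

    The sets [Sigma] inherit the limit.  Their enlargement [eps_block] is
    nonnegative and of order [1 / n]; for [n > 2] the intersection with
    [sigma_hat] involves only sections of size at least [n]; and one leading
    section of size at least [n] already provides the points needed for the
    opposite inclusion ([Sigma_close]).  The comparison with the
    pseudospectrum of the full matrix follows by the triangle inequality. *)

(** * Euclidean norms and the Schur test *)

Section EuclideanNorm.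
Context {R : realType}.
Local Notation C := R[i].

Definition enorm (I : finType) (F : I -> C) : R :=
  Num.sqrt (\sum_i normc (F i) ^+ 2).

Lemma normc_ge0 (z : C) : 0 <= normc z.
Proof. by case: z => x y; exact: sqrtr_ge0. Qed.

Lemma normc_real (z : C) : `|z| = (normc z)%:C.
Proof. by rewrite normc_def; case: z. Qed.

Lemma sqr_normcE (z : C) : normc z ^+ 2 = complex.Re z ^+ 2 + complex.Im z ^+ 2.
Proof. by case: z => x y /=; rewrite sqr_sqrtr// addr_ge0// sqr_ge0. Qed.

Lemma normc_sum (I : finType) (P : pred I) (F : I -> C) :
  normc (\sum_(i | P i) F i) <= \sum_(i | P i) normc (F i).
Proof.
elim/big_ind2: _ => //; first by rewrite normc0.
by move=> x a y b xa yb; exact: le_trans (le_normcD _ _) (lerD xa yb).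
Qed.

Lemma normc_conj (z : C) : normc z^* = normc z.
Proof. by case: z => x y /=; rewrite sqrrN. Qed.

Lemma normc_distC (x y : C) : normc (x - y) = normc (y - x).
Proof. by rewrite -normcN opprB. Qed.

Lemma normc_re (r : R) : normc (r%:C) = `|r|.
Proof. by rewrite /= expr0n addr0 sqrtr_sqr. Qed.

Lemma sumsq_ge0 (I : finType) (P : pred I) (F : I -> C) :
  0 <= \sum_(i | P i) normc (F i) ^+ 2.
Proof. by apply: sumr_ge0 => i _; exact: sqr_ge0. Qed.

Lemma enorm_ge0 (I : finType) (F : I -> C) : 0 <= enorm F.
Proof. exact: sqrtr_ge0. Qed.

Lemma sqr_enorm (I : finType) (F : I -> C) :
  enorm F ^+ 2 = \sum_i normc (F i) ^+ 2.
Proof. by rewrite sqr_sqrtr// sumsq_ge0. Qed.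

Lemma eq_enorm (I : finType) (F G : I -> C) : F =1 G -> enorm F = enorm G.
Proof. by move=> FG; rewrite /enorm; under eq_bigr do rewrite FG. Qed.

Lemma sum_cauchy_schwarz (I : finType) (u v : I -> R) :
  (\sum_i u i * v i) ^+ 2 <= (\sum_i u i ^+ 2) * (\sum_i v i ^+ 2).
Proof.
set A := \sum_i u i ^+ 2; set D := \sum_i v i ^+ 2; set B := \sum_i _.
have D0 : 0 <= D by apply: sumr_ge0 => i _; exact: sqr_ge0.
have : 0 <= \sum_i (D * u i - B * v i) ^+ 2.
  by apply: sumr_ge0 => i _; exact: sqr_ge0.
have -> : \sum_i (D * u i - B * v i) ^+ 2 = D * (D * A - B ^+ 2).
  transitivity (\sum_i (D ^+ 2 * u i ^+ 2 - 2 * D * B * (u i * v i)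
                        + B ^+ 2 * v i ^+ 2)).
    by apply: eq_bigr => i _; ring.
  rewrite !big_split /= sumrN -!mulr_sumr -/A -/B -/D; ring.
move: D0; rewrite le_eqVlt => /predU1P[D0 _|D0].
  suff -> : B = 0 by rewrite expr0n mulr_ge0// -?D0// sumr_ge0// => i _; exact: sqr_ge0.
  apply: big1 => i _.
  have /(_ i isT)/eqP := psumr_eq0P (fun i _ => sqr_ge0 (v i)) (esym D0).
  by rewrite sqrf_eq0 => /eqP ->; rewrite mulr0.
by rewrite pmulr_rge0// subr_ge0 mulrC.
Qed.

Lemma enormD (I : finType) (F G : I -> C) :
  enorm (fun i => F i + G i) <= enorm F + enorm G.
Proof.
rewrite -(ler_pXn2r (n := 2))// ?nnegrE ?addr_ge0 ?enorm_ge0//.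
rewrite sqrrD !sqr_enorm.
have CS : \sum_i normc (F i) * normc (G i) <= enorm F * enorm G.
  rewrite -(ler_pXn2r (n := 2))// ?nnegrE ?mulr_ge0 ?enorm_ge0//.
    by rewrite exprMn !sqr_enorm sum_cauchy_schwarz.
  by apply: sumr_ge0 => i _; rewrite mulr_ge0 ?normc_ge0.
have : \sum_i normc (F i + G i) ^+ 2 <=
       \sum_i normc (F i) ^+ 2 + (\sum_i normc (F i) * normc (G i)) *+ 2
       + \sum_i normc (G i) ^+ 2.
  rewrite -sumrMnl -!big_split /=; apply: ler_sum => i _.
  by rewrite -sqrrD ler_pXn2r// ?nnegrE ?addr_ge0 ?normc_ge0// le_normcD.
move=> /le_trans; apply.
by rewrite lerD2r lerD2l lerMn2r.
Qed.

Lemma enormZ (I : finType) (c : C) (F : I -> C) :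
  enorm (fun i => c * F i) = normc c * enorm F.
Proof.
rewrite /enorm; under eq_bigr do rewrite normcM exprMn.
by rewrite -mulr_sumr sqrtrM ?sqr_ge0// sqrtr_sqr ger0_norm ?normc_ge0.
Qed.

Lemma enormN (I : finType) (F : I -> C) : enorm (fun i => - F i) = enorm F.
Proof. by rewrite /enorm; under eq_bigr do rewrite normcN. Qed.

Lemma enormB (I : finType) (F G : I -> C) :
  enorm F - enorm G <= enorm (fun i => F i - G i).
Proof.
rewrite lerBlDr (@eq_enorm _ F (fun i => (F i - G i) + G i)) ?enormD//.
by move=> i; rewrite subrK.
Qed.

Lemma enorm0_eq0 (I : finType) (F : I -> C) : enorm F = 0 -> F =1 fun=> 0.
Proof.
move=> /(congr1 (fun r => r ^+ 2)); rewrite sqr_enorm expr0n => F0 i.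
have /(_ i isT)/eqP := psumr_eq0P (fun i _ => sqr_ge0 (normc (F i))) F0.
by rewrite sqrf_eq0 => /eqP/eq0_normc.
Qed.

Lemma enorm0 (I : finType) : enorm (fun _ : I => 0) = 0.
Proof. by rewrite /enorm big1 ?sqrtr0// => i _; rewrite normc0 expr0n. Qed.

(** Schur test: weighting the Cauchy-Schwarz inequality by [normc (K i j)]
    needs only row and column sums, so the bound for a banded Toeplitz matrix
    does not grow with its size. *)
Lemma schur_test (I J : finType) (K : I -> J -> C) (c : R) (x : J -> C) :
  (forall i, \sum_j normc (K i j) <= c) ->
  (forall j, \sum_i normc (K i j) <= c) -> 0 <= c ->
  enorm (fun i => \sum_j K i j * x j) <= c * enorm x.
Proof.
move=> rows cols c0.
rewrite -(ler_pXn2r (n := 2))// ?nnegrE ?mulr_ge0 ?enorm_ge0//.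
rewrite exprMn !sqr_enorm.
have row i : normc (\sum_j K i j * x j) ^+ 2 <=
             c * \sum_j normc (K i j) * normc (x j) ^+ 2.
  pose u j := Num.sqrt (normc (K i j)).
  have uu j : u j ^+ 2 = normc (K i j) by rewrite sqr_sqrtr// normc_ge0.
  have := sum_cauchy_schwarz u (fun j => u j * normc (x j)).
  under eq_bigr do rewrite mulrA -expr2 uu -normcM.
  under [X in _ <= X * _ -> _]eq_bigr do rewrite uu.
  under [X in _ <= _ * X -> _]eq_bigr do rewrite exprMn uu.
  move=> CS; apply: (@le_trans _ _ ((\sum_j normc (K i j * x j)) ^+ 2)).
    rewrite ler_pXn2r ?nnegrE ?normc_ge0 ?normc_sum//.
    by rewrite sumr_ge0// => j _; exact: normc_ge0.
  apply: (le_trans CS); apply: ler_wpM2r (rows i).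
  by rewrite sumr_ge0// => j _; rewrite mulr_ge0 ?normc_ge0 ?sqr_ge0.
apply: le_trans (ler_sum _ (fun i _ => row i)) _.
rewrite -mulr_sumr exchange_big /= expr2 -mulrA; apply: ler_wpM2l => //.
rewrite mulr_sumr; apply: ler_sum => j _.
by rewrite -mulr_suml; apply: ler_wpM2r (cols j); exact: sqr_ge0.
Qed.

End EuclideanNorm.

(** * Norms, lower bounds and pseudospectra of matrices *)

Section MatrixLowerBound.
Context {R : realType}.
Local Notation C := R[i].

Lemma norm2E n (x : 'cV[C]_n) : norm2 x = enorm (fun i => x i 0).
Proof. by []. Qed.

Lemma norm2_ge0 n (x : 'cV[C]_n) : 0 <= norm2 x.
Proof. exact: sqrtr_ge0. Qed.

Lemma norm2Z n (c : C) (x : 'cV[C]_n) : norm2 (c *: x) = normc c * norm2 x.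
Proof. by rewrite !norm2E -enormZ; apply: eq_enorm => i; rewrite mxE. Qed.

Lemma norm2D n (x y : 'cV[C]_n) : norm2 (x + y) <= norm2 x + norm2 y.
Proof.
rewrite !norm2E; apply: le_trans (enormD _ _).
by rewrite (@eq_enorm _ _ _ (fun i => x i 0 + y i 0))// => i; rewrite mxE.
Qed.

Lemma norm20 n : norm2 (0 : 'cV[C]_n) = 0.
Proof.
by rewrite norm2E -[RHS](enorm0 (R := R) 'I_n); apply: eq_enorm => i; rewrite mxE.
Qed.

Lemma norm2_eq0 n (x : 'cV[C]_n) : norm2 x = 0 -> x = 0.
Proof.
move=> /enorm0_eq0 x0; apply/matrixP => i j.
by rewrite ord1 x0 mxE.
Qed.

Lemma norm2B n (x y : 'cV[C]_n) : norm2 x - norm2 y <= norm2 (x - y).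
Proof. by rewrite lerBlDr -{1}(subrK y x) norm2D. Qed.

Lemma mulmx_schur m n (A : 'M[C]_(m, n)) (c : R) :
  (forall i, \sum_j normc (A i j) <= c) ->
  (forall j, \sum_i normc (A i j) <= c) -> 0 <= c ->
  forall x, norm2 (A *m x) <= c * norm2 x.
Proof.
move=> rows cols c0 x; rewrite !norm2E; apply: le_trans (schur_test _ rows cols c0).
by rewrite (@eq_enorm _ _ _ (fun i => \sum_j A i j * x j 0))// => i; rewrite mxE.
Qed.

Lemma mulmx_bounded m n (A : 'M[C]_(m, n)) :
  exists2 c : R, 0 <= c & forall x, norm2 (A *m x) <= c * norm2 x.
Proof.
have s0 : 0 <= \sum_i \sum_j normc (A i j).
  by apply: sumr_ge0 => i _; apply: sumr_ge0 => j _; exact: normc_ge0.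
exists (\sum_i \sum_j normc (A i j)) => //.
apply: mulmx_schur => // [i|j].
  rewrite [leRHS](bigD1 i)//= lerDl; apply: sumr_ge0 => k _.
  by apply: sumr_ge0 => j _; exact: normc_ge0.
apply: ler_sum => i _; rewrite (bigD1 j)//= lerDl.
by apply: sumr_ge0 => k _; exact: normc_ge0.
Qed.

Lemma mxopnorm_le m n (A : 'M[C]_(m, n)) (c : R) : 0 <= c ->
  (forall x, norm2 (A *m x) <= c * norm2 x) -> mxopnorm A <= c.
Proof.
move=> c0 Ac; apply: ge_sup.
  by exists (norm2 (A *m 0)), 0 => //=; rewrite norm20 ler01.
move=> _ [x /= x1 <-]; apply: le_trans (Ac x) _.
by rewrite -[leRHS]mulr1 ler_wpM2l.
Qed.

Lemma norm2_mulmx m n (A : 'M[C]_(m, n)) x :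
  norm2 (A *m x) <= mxopnorm A * norm2 x.
Proof.
have [c c0 Ac] := mulmx_bounded A.
have [x0|x0] := eqVneq (norm2 x) 0.
  by have := Ac x; rewrite x0 !mulr0.
have xp : 0 < norm2 x by rewrite lt_neqAle eq_sym x0 norm2_ge0.
rewrite -ler_pdivrMr//.
have E (y : 'cV[C]_m) : normc ((norm2 x)^-1)%:C * norm2 y = norm2 y / norm2 x.
  by rewrite normc_re ger0_norm ?invr_ge0 ?norm2_ge0// mulrC.
rewrite -E -norm2Z; apply: ub_le_sup.
  exists c => _ [y /= y1 <-]; apply: le_trans (Ac y) _.
  by rewrite -[leRHS]mulr1 ler_wpM2l.
exists ((norm2 x)^-1%:C *: x); last by rewrite scalemxAr.
by rewrite /= norm2Z normc_re ger0_norm ?invr_ge0 ?norm2_ge0// mulVf.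
Qed.

Lemma mxopnorm_ge0 m n (A : 'M[C]_(m, n)) : 0 <= mxopnorm A.
Proof.
have [c c0 Ac] := mulmx_bounded A.
apply: le_trans (norm2_ge0 (A *m 0)) _; apply: ub_le_sup; last first.
  by exists 0 => //=; rewrite norm20 ler01.
exists c => _ [y /= y1 <-]; apply: le_trans (Ac y) _.
by rewrite -[leRHS]mulr1 ler_wpM2l.
Qed.

(** The quantity [mx_invnormV E] is the largest admissible [k] when [E] is
    square and nonempty; lower bounds are easier to transport between sections
    and operators than norms of inverses. *)
Definition mx_below n (E : 'M[C]_n) (k : R) :=
  forall x : 'cV[C]_n, k * norm2 x <= norm2 (E *m x).

Lemma mx_below_le n (E : 'M[C]_n) k k' : k' <= k -> mx_below E k -> mx_below E k'.
Proof. by move=> kk Ek x; apply: le_trans (Ek x); rewrite ler_wpM2r ?norm2_ge0. Qed.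

Lemma mx_below_unit n (E : 'M[C]_n) k : 0 < k -> mx_below E k -> E \in unitmx.
Proof.
move=> k0 Ek; rewrite -unitmx_tr -row_free_unit -kermx_eq0.
apply/eqP/row_matrixP => i; rewrite row0; set u := row i _.
have uE : u *m E^T = 0 by rewrite /u -row_mul mulmx_ker row0.
have : E *m u^T = 0 by rewrite -[E]trmxK -trmx_mul uE trmx0.
have := Ek u^T => /[swap] -> ; rewrite norm20 pmulr_rle0// => u0.
have /norm2_eq0 : norm2 u^T = 0 by apply/eqP; rewrite eq_le u0 norm2_ge0.
by move=> /(congr1 trmx); rewrite trmxK trmx0.
Qed.

Lemma mx_below_inv n (E : 'M[C]_n) k : 0 < k -> mx_below E k ->
  forall y, norm2 (invmx E *m y) <= k^-1 * norm2 y.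
Proof.
move=> k0 Ek y; have Eu := mx_below_unit k0 Ek.
by rewrite mulrC ler_pdivlMr// mulrC; apply: le_trans (Ek _) _; rewrite mulKVmx.
Qed.

Lemma mx_invnormV_ge n (E : 'M[C]_n) k : (0 < n)%N -> 0 < k ->
  mx_below E k -> k <= mx_invnormV E.
Proof.
case: n E => // n E _ k0 Ek; have Eu := mx_below_unit k0 Ek.
rewrite /mx_invnormV Eu -[k]invrK lef_pV2 ?posrE ?invr_gt0//.
  apply: mxopnorm_le; first by rewrite invr_ge0 ltW.
  exact: mx_below_inv.
rewrite lt_neqAle mxopnorm_ge0 andbT; apply/eqP => z.
have : (1%:M : 'M[C]_n.+1) = 0.
  apply/matrixP => i j; rewrite -(mulVmx Eu).
  have /norm2_eq0 : norm2 (invmx E *m col j E) = 0.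
    apply/eqP; rewrite eq_le norm2_ge0 andbT.
    by apply: le_trans (norm2_mulmx _ _) _; rewrite -z mul0r.
  by rewrite colE mulmxA -colE => /matrixP/(_ i 0); rewrite !mxE.
by apply/eqP; exact: oner_neq0.
Qed.

Lemma mx_belowP n (E : 'M[C]_n) k : k <= mx_invnormV E -> mx_below E k.
Proof.
rewrite /mx_invnormV; case: ifPn => [Eu kE x|_ k0 x]; last first.
  by apply: le_trans (norm2_ge0 _); rewrite mulr_le0_ge0 ?norm2_ge0.
have [k0|k0] := leP k 0.
  by apply: le_trans (norm2_ge0 _); rewrite mulr_le0_ge0 ?norm2_ge0.
have p0 : 0 < mxopnorm (invmx E) by rewrite -invr_gt0; exact: lt_le_trans kE.
apply: (@le_trans _ _ ((mxopnorm (invmx E))^-1 * norm2 x)).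
  by rewrite ler_wpM2r ?norm2_ge0.
rewrite mulrC ler_pdivrMr// mulrC -{1}(mulKmx Eu x); exact: norm2_mulmx.
Qed.

(** Strictness comes from [mx_invnormV] itself being an attained lower bound. *)
Lemma not_mx_pspecP n (E : 'M[C]_n) (eps : R) l : (0 < n)%N -> 0 <= eps ->
  ~ mx_pspec eps E l <-> exists2 k, eps < k & mx_below (E - l%:M) k.
Proof.
move=> n0 e0; rewrite /mx_pspec /=; split=> [/negP|[k ek Ek]].
  by rewrite -ltNge => h; exists (mx_invnormV (E - l%:M)) => //; exact: mx_belowP.
apply/negP; rewrite -ltNge; apply: (lt_le_trans ek).
by apply: mx_invnormV_ge => //; exact: le_lt_trans ek.
Qed.

Lemma mx_pspec_mono n (E : 'M[C]_n) (e e' : R) : e <= e' ->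
  mx_pspec e E `<=` mx_pspec e' E.
Proof. by move=> ee l /= h; exact: le_trans ee. Qed.

Lemma mx_spec_pspec n (E : 'M[C]_n) (e : R) : 0 <= e -> mx_spec E `<=` mx_pspec e E.
Proof.
by move=> e0 l /= Eu; rewrite /mx_pspec /= /mx_invnormV (negPf Eu).
Qed.

Lemma mx_pspec0E n (E : 'M[C]_n) : (0 < n)%N -> mx_pspec 0 E = mx_spec E.
Proof.
move=> n0; apply/seteqP; split; last exact: mx_spec_pspec.
move=> l h; apply/negP => Eu; have [c c0 Ec] := mulmx_bounded (invmx (E - l%:M)).
suff : ~ mx_pspec 0 E l by [].
apply/not_mx_pspecP => //; exists (c + 1)^-1; first by rewrite invr_gt0 ltr_wpDl.
move=> x; rewrite mulrC ler_pdivrMr ?ltr_wpDl// mulrC.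
rewrite -{1}(mulKmx Eu x); apply: le_trans (Ec _) _.
by rewrite ler_wpM2r ?norm2_ge0// lerDl ler01.
Qed.

Lemma mx_spec_neq0 n (E : 'M[C]_n) : (0 < n)%N -> mx_spec E !=set0.
Proof.
move=> n0; have [l /eigenvalueP[v vE v0]] := eigenvalue_closed E n0.
exists l; apply/negP => Eu; move/eqP: v0; apply.
have : v *m (E - l%:M) = 0 by rewrite mulmxBr vE mul_mx_scalar subrr.
by move=> /(congr1 (mulmx^~ (invmx (E - l%:M)))); rewrite mulmxK// mul0mx.
Qed.

End MatrixLowerBound.

(** * Resolvent bounds on a disc *)

Section ResolventGrowth.
Context {R : realType}.
Local Notation C := R[i].

Lemma norm2_parallelogram n (p q : 'cV[C]_n) :
  norm2 (p + q) ^+ 2 + norm2 (p - q) ^+ 2 = 2 * (norm2 p ^+ 2 + norm2 q ^+ 2).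
Proof.
rewrite !norm2E !sqr_enorm -!big_split /= mulr_sumr; apply: eq_bigr => i _.
rewrite !mxE !sqr_normcE; case: (p i 0) (q i 0) => [a b] [a' b'] /=; ring.
Qed.

Lemma normc_exp (z : C) k : normc (z ^+ k) = normc z ^+ k.
Proof. by elim: k => [|k IH]; rewrite ?expr0 ?normc1// !exprS normcM IH. Qed.

(** Two applications of the parallelogram law to the even and odd parts of the
    polynomial, at [z] and at ['i * z], cancel every cross term.  This is
    Parseval's identity on a circle, discretised at four points. *)
Lemma four_roots_average n (x0 x1 x2 x3 : 'cV[C]_n) (z : C)
    (p := fun s : C => x0 + s *: x1 + (s ^+ 2) *: x2 + (s ^+ 3) *: x3) :
  4 * (norm2 x0 ^+ 2 + normc z ^+ 2 * norm2 x1 ^+ 2) <=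
  norm2 (p z) ^+ 2 + norm2 (p (- z)) ^+ 2 +
  (norm2 (p ('i * z)) ^+ 2 + norm2 (p (- ('i * z))) ^+ 2).
Proof.
have i2 : 'i ^+ 2 = -1 :> C by exact: sqr_i.
have pE s : p s = (x0 + s ^+ 2 *: x2) + (s *: x1 + s ^+ 3 *: x3).
  by rewrite /p -!addrA; congr (_ + _); rewrite addrCA.
have pN s : p (- s) = (x0 + s ^+ 2 *: x2) - (s *: x1 + s ^+ 3 *: x3).
  by rewrite pE sqrrN exprNn -signr_odd /= expr1 mulN1r !scaleNr -opprD.
rewrite (pN z) (pN ('i * z)) (pE z) (pE ('i * z)).
do 2![rewrite norm2_parallelogram]; rewrite -mulrDr.
rewrite addrACA.
have -> : ('i * z) ^+ 2 *: x2 = - (z ^+ 2 *: x2).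
  by rewrite exprMn i2 mulN1r scaleNr.
have -> : ('i * z) *: x1 + ('i * z) ^+ 3 *: x3 = 'i *: (z *: x1 - z ^+ 3 *: x3).
  have i3 : 'i ^+ 3 = - 'i :> C by rewrite exprS i2 mulrN1.
  by rewrite exprMn i3 scalerBr mulNr scaleNr !scalerA.
rewrite norm2_parallelogram (norm2Z 'i).
have -> : normc ('i : C) = 1 by rewrite /= expr0n expr1n add0r sqrtr1.
rewrite mul1r norm2_parallelogram !norm2Z normc_exp.
rewrite !exprMn.
have := sqr_ge0 (norm2 x2); have := sqr_ge0 (norm2 x3).
have : 0 <= (normc (z ^+ 3)) ^+ 2 by exact: sqr_ge0.
have : 0 <= (normc z ^+ 2) ^+ 2 by exact: sqr_ge0.
nra.
Qed.

(** Up to the term of order four, the polynomial in [s] is the image of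
    [E *m x0] under the Neumann series of the resolvent at [s]. *)
Lemma mulmx_telescope n (E : 'M[C]_n) (x0 x1 x2 x3 : 'cV[C]_n) (s : C) :
  E *m x1 = x0 -> E *m x2 = x1 -> E *m x3 = x2 ->
  (E - s%:M) *m (x0 + s *: x1 + (s ^+ 2) *: x2 + (s ^+ 3) *: x3) =
  E *m x0 - (s ^+ 4) *: x3.
Proof.
move=> E1 E2 E3; rewrite mulmxBl mul_scalar_mx !mulmxDr.
rewrite -(scalemxAr s) -(scalemxAr (s ^+ 2)) -(scalemxAr (s ^+ 3)) E1 E2 E3.
by move: (E *m x0) => y; apply/matrixP => i j; rewrite !mxE; ring.
Qed.

Lemma four_bounds (s e g n1 n2 n3 n4 : R) :
  e * n1 <= g -> e * n2 <= g -> e * n3 <= g -> e * n4 <= g ->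
  4 * s <= n1 + n2 + (n3 + n4) -> 0 <= e -> e * s <= g.
Proof. by move=> h1 h2 h3 h4 h e0; have := ler_wpM2l e0 h; lra. Qed.

(** If the resolvent has norm at most [eps^-1] at [0] and at the four points
    of modulus [r] on the axes, averaging its squared norm over these points
    forces it to be strictly smaller at the centre: the average exceeds the
    central value by at least [r ^+ 2] times the squared norm of the linear
    coefficient, which is at least [c ^-2] in relative size, while truncating
    the series costs only [r ^+ 4]. *)
Lemma mx_below_improve n (E : 'M[C]_n) (eps r c : R) : 0 < eps -> 0 < r -> 0 < c ->
  (forall x, norm2 (E *m x) <= c * norm2 x) ->
  mx_below E eps ->
  (forall z, normc z = r -> mx_below (E - z%:M) eps) ->
  r <= c ->
  mx_below E (eps + eps * (r ^+ 2 / (3 * c ^+ 2)) - r ^+ 4 / eps ^+ 3).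
Proof.
move=> e0 r0 c0 Ec E0 Ez rc x.
have Eu := mx_below_unit e0 E0.
pose F := invmx E.
have Fle y : norm2 (F *m y) <= eps^-1 * norm2 y by exact: mx_below_inv.
pose x2 := F *m x; pose x1 := F *m x2; pose u := F *m x1.
have Ex2 : E *m x2 = x by rewrite mulKVmx.
have Ex1 : E *m x1 = x2 by rewrite mulKVmx.
have Eu1 : E *m u = x1 by rewrite mulKVmx.
pose G := norm2 (E *m x) + r ^+ 4 / eps ^+ 3 * norm2 x.
have G0 : 0 <= G.
  by rewrite addr_ge0 ?norm2_ge0// mulr_ge0 ?norm2_ge0 ?divr_ge0 ?exprn_ge0 ?ltW.
have ux : norm2 u <= eps ^- 3 * norm2 x.
  apply: le_trans (Fle x1) _; rewrite -exprVn exprS -mulrA ler_wpM2l ?invr_ge0 ?(ltW e0)//.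
  apply: le_trans (Fle x2) _; rewrite exprS -mulrA ler_wpM2l ?invr_ge0 ?(ltW e0)//.
  by rewrite expr1; exact: Fle.
pose p (s : C) := x + s *: x2 + (s ^+ 2) *: x1 + (s ^+ 3) *: u.
have key s : normc s = r -> s ^+ 4 = (r ^+ 4)%:C -> eps ^+ 2 * norm2 (p s) ^+ 2 <= G ^+ 2.
  move=> sr s4; rewrite -exprMn ler_pXn2r ?nnegrE ?mulr_ge0 ?norm2_ge0 ?(ltW e0)//.
  apply: le_trans (Ez s sr (p s)) _.
  have -> : (E - s%:M) *m p s = E *m x - (s ^+ 4) *: u by exact: mulmx_telescope.
  rewrite s4 -scaleNr; apply: le_trans (norm2D _ _) _; rewrite lerD2l norm2Z.
  rewrite normcN normc_re ger0_norm ?exprn_ge0 ?(ltW r0)// -mulrA.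
  by rewrite ler_wpM2l ?exprn_ge0 ?(ltW r0).
have nr : normc (r%:C : C) = r by rewrite normc_re ger0_norm ?ltW.
have ni : normc ('i * r%:C : C) = r.
  by rewrite normcM nr /= expr0n expr1n add0r sqrtr1 mul1r.
have i4 : ('i * r%:C) ^+ 4 = (r ^+ 4)%:C :> C.
  by rewrite exprMn (exprM _ 2 2) sqr_i sqrrN expr1n mul1r rmorphXn.
have r4 : (r%:C) ^+ 4 = (r ^+ 4)%:C :> C by rewrite rmorphXn.
have N4 (s : C) : (- s) ^+ 4 = s ^+ 4 by rewrite exprNn -signr_odd /= mul1r.
have k1 := key _ nr r4.
have k2 : eps ^+ 2 * norm2 (p (- r%:C)) ^+ 2 <= G ^+ 2 by apply: key; rewrite ?normcN ?N4.
have k3 := key _ ni i4.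
have k4 : eps ^+ 2 * norm2 (p (- ('i * r%:C))) ^+ 2 <= G ^+ 2 by apply: key; rewrite ?normcN ?N4.
have avg : 4 * (norm2 x ^+ 2 + r ^+ 2 * norm2 x2 ^+ 2) <=
    norm2 (p r%:C) ^+ 2 + norm2 (p (- r%:C)) ^+ 2 +
    (norm2 (p ('i * r%:C)) ^+ 2 + norm2 (p (- ('i * r%:C))) ^+ 2).
  by have := four_roots_average x x2 x1 u r%:C; rewrite nr.
have x2c : norm2 x <= c * norm2 x2 by rewrite -{1}Ex2.
set s := r ^+ 2 / (3 * c ^+ 2).
have s0 : 0 <= s by rewrite divr_ge0 ?exprn_ge0 ?mulr_ge0 ?exprn_ge0 ?ltW.
(* Averaging the four bounds; [3 * s] is the relative gain [r ^+ 2 / c ^+ 2]. *)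
have main : (eps * norm2 x) ^+ 2 * (1 + 3 * s) <= G ^+ 2.
  have e2 : 0 <= eps ^+ 2 by exact: sqr_ge0.
  have B1 : eps ^+ 2 * (norm2 x ^+ 2 + r ^+ 2 * norm2 x2 ^+ 2) <= G ^+ 2.
    exact: four_bounds k1 k2 k3 k4 avg e2.
  apply: le_trans B1; rewrite exprMn -mulrA ler_wpM2l// mulrDr mulr1 lerD2l.
  have -> : 3 * s = r ^+ 2 / c ^+ 2.
    by rewrite /s; field; rewrite gt_eqF.
  rewrite mulrCA ler_wpM2l ?sqr_ge0// ler_pdivrMr ?exprn_gt0// mulrC -exprMn.
  by rewrite ler_pXn2r ?nnegrE ?mulr_ge0 ?norm2_ge0 ?(ltW c0).
have s1 : s <= 3^-1.
  rewrite /s ler_pdivrMr ?mulr_gt0 ?exprn_gt0// mulrA mulVf// mul1r.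
  by rewrite ler_pXn2r ?nnegrE ?(ltW r0) ?(ltW c0).
have : eps * norm2 x * (1 + s) <= G.
  rewrite -(ler_pXn2r (n := 2))// ?nnegrE ?mulr_ge0 ?norm2_ge0 ?addr_ge0 ?(ltW e0)//.
  apply: le_trans main; rewrite exprMn ler_wpM2l ?sqr_ge0//.
  by move: s0 s1; clear; move: s => s s0 s1; nra.
rewrite /G -lerBlDr; apply: le_trans.
by rewrite le_eqVlt; apply/orP; left; apply/eqP; ring.
Qed.

(** A resolvent norm that is at most [eps^-1] on a disc is below a smaller
    constant at its centre.  The point is that [k] depends on the matrix only
    through its norm, so that it survives the passage to the limit of infinite
    size: this is a quantitative form of the fact that the resolvent norm of an
    operator on a Hilbert space is nowhere locally constant. *)
Lemma resolvent_growth (eps eta c : R) : 0 < eps -> 0 < eta -> 0 < c ->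
  exists2 k, eps < k & forall n (E : 'M[C]_n),
    (forall x, norm2 (E *m x) <= c * norm2 x) ->
    (forall z, normc z < eta -> mx_below (E - z%:M) eps) -> mx_below E k.
Proof.
move=> e0 t0 c0.
(* The last bound makes the gain of order [r ^+ 2] beat the loss of order
   [r ^+ 4]. *)
pose r := Num.min (eta / 2) (Num.min c (eps ^+ 2 / (2 * c))).
have q0 : 0 < eps ^+ 2 / (2 * c) by rewrite divr_gt0 ?exprn_gt0 ?mulr_gt0.
have r0 : 0 < r by rewrite !lt_min divr_gt0//= c0.
have rt : r < eta.
  by rewrite (@le_lt_trans _ _ (eta / 2)) ?ge_min ?lexx// ltr_pdivrMr// ltr_pMr// ltr1n.
have rc : r <= c by rewrite !ge_min lexx orbT.
have rq : r <= eps ^+ 2 / (2 * c) by rewrite !ge_min lexx !orbT.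
exists (eps + eps * (r ^+ 2 / (3 * c ^+ 2)) - r ^+ 4 / eps ^+ 3).
  rewrite -addrA ltrDl subr_gt0 ltr_pdivrMr ?exprn_gt0//.
  have -> : eps * (r ^+ 2 / (3 * c ^+ 2)) * eps ^+ 3 =
      r ^+ 2 * ((eps ^+ 2 / (2 * c)) ^+ 2 * (4 / 3)).
    by field; rewrite gt_eqF.
  rewrite (exprD _ 2 2) ltr_pM2l ?exprn_gt0//.
  apply: (@le_lt_trans _ _ ((eps ^+ 2 / (2 * c)) ^+ 2)).
    by rewrite ler_pXn2r ?nnegrE ?(ltW r0) ?(ltW q0).
  by rewrite ltr_pMr ?exprn_gt0//; lra.
move=> n E Ec Ez; apply: mx_below_improve => //.
  by have := Ez 0; rewrite normc0 raddf0 subr0; exact.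
by move=> z zr; apply: Ez; rewrite zr.
Qed.

Lemma norm2_unitary n (P : 'M[C]_n) (x : 'cV[C]_n) :
  P \is unitarymx -> norm2 (P *m x) = norm2 x.
Proof.
have dotE (y : 'cV[C]_n) : (norm2 y ^+ 2)%:C = ((map_mx Num.conj y)^T *m y) 0 0.
  rewrite norm2E sqr_enorm mxE rmorph_sum; apply: eq_bigr => i _.
  by rewrite !mxE mulrC -normCK normc_real rmorphXn.
move=> Pu; have /(unitarymx_unit)/mulVmx := Pu.
rewrite (invmx_unitary Pu) => PP.
have : (norm2 (P *m x) ^+ 2)%:C = (norm2 x ^+ 2)%:C :> C.
  rewrite !dotE map_mxM trmx_mul -mulmxA.
  by rewrite (mulmxA _ _ x) (map_trmx _ P) PP mul1mx.
move=> /(congr1 (@complex.Re R)) /= /eqP.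
by rewrite eqrXn2 ?norm2_ge0// => /eqP.
Qed.

Lemma diag_below n (d : 'rV[C]_n) (eta : R) : 0 <= eta ->
  (forall i, eta <= normc (d 0 i)) -> mx_below (diag_mx d) eta.
Proof.
move=> t0 dge y.
rewrite -(ler_pXn2r (n := 2)) ?nnegrE ?mulr_ge0 ?norm2_ge0//.
rewrite exprMn !norm2E !sqr_enorm mulr_sumr; apply: ler_sum => i _.
rewrite mul_diag_mx mxE normcM exprMn ler_wpM2r ?sqr_ge0//.
by rewrite ler_pXn2r ?nnegrE ?normc_ge0.
Qed.

Lemma similar_sub_scalar n (P D : 'M[C]_n) (c : C) : P \in unitmx ->
  invmx P *m D *m P - c%:M = invmx P *m (D - c%:M) *m P.
Proof.
by move=> Pv; rewrite mulmxBr mulmxBl mul_mx_scalar -scalemxAl mulVmx// scalemx1.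
Qed.

Lemma diag_mx_sub_scalar n (d : 'rV[C]_n) (c : C) :
  diag_mx d - c%:M = diag_mx (d - const_mx c).
Proof. by rewrite -diag_const_mx -raddfB. Qed.

Lemma similar_diag_spec n (P : 'M[C]_n) (d : 'rV[C]_n) i : P \in unitmx ->
  invmx P *m diag_mx d *m P - (d 0 i)%:M \notin unitmx.
Proof.
move=> Pv; rewrite similar_sub_scalar// diag_mx_sub_scalar.
rewrite !unitmx_mul unitmx_inv Pv andbT /= unitmxE unitfE negbK det_diag.
by apply/eqP; rewrite (bigD1 i)//= !mxE subrr mul0r.
Qed.

Lemma unitary_similar_below n (P D : 'M[C]_n) (eta : R) : P \is unitarymx ->
  mx_below D eta -> mx_below (invmx P *m D *m P) eta.
Proof.
move=> Pu Db x; have Vu : invmx P \is unitarymx by rewrite (invmx_unitary Pu) trmxC_unitary.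
rewrite -[_ *m P]mulmxA -mulmxA (norm2_unitary _ Vu) -(norm2_unitary x Pu) -mulmxA; exact: Db.
Qed.

(** For a normal matrix the spectral theorem turns the distance from [l] to
    the spectrum into a lower bound. *)
Lemma normal_below n (E : 'M[C]_n) (l : C) (eta : R) : 0 <= eta ->
  E \is normalmx ->
  (forall z, normc (z - l) < eta -> E - z%:M \in unitmx) ->
  mx_below (E - l%:M) eta.
Proof.
move=> t0 /orthomx_spectralP EE Ez; rewrite EE.
rewrite similar_sub_scalar ?spectral_unit// diag_mx_sub_scalar.
apply: unitary_similar_below; first exact: spectral_unitarymx.
apply: diag_below => // i; rewrite !mxE leNgt; apply/negP => /Ez; rewrite {1}EE.
by apply/negP; exact: similar_diag_spec (spectral_unit E).
Qed.

End ResolventGrowth.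

(** * Finite sections of banded Toeplitz matrices *)

Section ToeplitzSections.
Context {R : realType}.
Local Notation C := R[i].
Implicit Types (b : int -> C) (x y : nat -> C) (w p q M : nat).

Definition snorm n x : R := enorm (fun k : 'I_n => x k).

(** The [p]-th finite section of the Toeplitz matrix applied to the first [p]
    entries of [x].  The output is kept as a full sequence: its rows beyond [p]
    are those of a rectangular section. *)
Definition conv b p x : nat -> C :=
  fun i => \sum_(j < p) b (i%:Z - j%:Z) * x j.

Definition banded w b := forall j : int, (w < `|j|)%N -> b j = 0.

(** The symbol of the transposed Toeplitz matrix. *)
Definition reversed b : int -> C := fun j => b (- j).

Definition shifted b (l : C) : int -> C := fun j => b j - (if j == 0 then l else 0).

Definition band_sum w b : R := \sum_(k < w.*2.+1) normc (b (k%:Z - w%:Z)).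

Lemma banded_shifted w b l : banded w b -> banded w (shifted b l).
Proof.
move=> bw j wj; rewrite /shifted bw//; case: eqP => [j0|_]; last by rewrite subr0.
by move: wj; rewrite j0.
Qed.

Lemma toeplitz_shifted b l M : toeplitz b M - l%:M = toeplitz (shifted b l) M.
Proof.
apply/matrixP => i j; rewrite !mxE /shifted subr_eq0 eqz_nat (inj_eq val_inj).
by case: eqP => _; rewrite ?mulr1n ?mulr0n.
Qed.

Lemma conv_shifted b l p x i : (i < p)%N ->
  conv (shifted b l) p x i = conv b p x i - l * x i.
Proof.
move=> ip; transitivity (conv b p x i
    - \sum_(j < p) (if j == Ordinal ip then l * x j else 0)); last first.
  by congr (_ - _); rewrite -big_mkcond big_pred1_eq.
rewrite /conv -sumrB; apply: eq_bigr => j _; rewrite /shifted mulrBl; congr (_ - _).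
rewrite subr_eq0 eqz_nat -(inj_eq val_inj) eq_sym /=.
by case: ifP; rewrite ?mul0r.
Qed.

Lemma toeplitz_op_shifted b l w :
  (fun x k => toeplitz_op b w x k - l * x k) = toeplitz_op (shifted b l) w.
Proof.
apply/funext => x; apply/funext => i.
by rewrite -[RHS]/(conv _ (i + w.+1) x i) conv_shifted// addnS ltnS leq_addr.
Qed.

Lemma band_sum_ge0 w b : 0 <= band_sum w b.
Proof. by apply: sumr_ge0 => i _; exact: normc_ge0. Qed.

(** Along an injective family of indices each coefficient in the band is met
    at most once. *)
Lemma sum_band_le w b (I : finType) (g : I -> int) : injective g -> banded w b ->
  \sum_i normc (b (g i)) <= band_sum w b.
Proof.
move=> gI bw.
have F i : normc (b (g i)) =
    \sum_(k < w.*2.+1) (if g i == k%:Z - w%:Z then normc (b (k%:Z - w%:Z)) else 0).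
  have [gw|gw] := ltnP w `|g i|.
    rewrite bw// normc0 big1// => k _; case: eqP => // gk.
    by move: gw; rewrite gk; have := ltn_ord k; lia.
  have kw : (absz (g i + w%:Z)%R < w.*2.+1)%N by lia.
  rewrite (bigD1 (Ordinal kw))//= big1 => [|k /eqP kn]; last first.
    case: eqP => // gk; case: kn; apply: val_inj => /=; lia.
  have -> : (absz (g i + w%:Z)%R)%:Z - w%:Z = g i by lia.
  by rewrite eqxx addr0.
under eq_bigr do rewrite F.
rewrite exchange_big /=; apply: ler_sum => k _.
have [[i0 gi]|none] := pselect (exists i, g i = k%:Z - w%:Z).
  rewrite (bigD1 i0)//= gi eqxx big1 ?addr0// => i /eqP ii0.
  by case: eqP => // gik; case: ii0; apply: gI; rewrite gi.
rewrite big1 ?normc_ge0// => i _; case: eqP => // gi.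
by case: none; exists i.
Qed.

Lemma conv_bounded w b p q x : banded w b ->
  snorm q (conv b p x) <= band_sum w b * snorm p x.
Proof.
move=> bw; apply: schur_test; last exact: band_sum_ge0.
  move=> i; apply: (sum_band_le (g := fun j : 'I_p => i%:Z - j%:Z)) => // j k jk.
  by apply: val_inj => /=; lia.
move=> j; apply: (sum_band_le (g := fun i : 'I_q => i%:Z - j%:Z)) => // i k ik.
by apply: val_inj => /=; lia.
Qed.

Lemma snorm_ge0 n x : 0 <= snorm n x.
Proof. exact: enorm_ge0. Qed.

Lemma snorm_sq n x : snorm n x ^+ 2 = \sum_(k < n) normc (x k) ^+ 2.
Proof. exact: sqr_enorm. Qed.

Lemma snorm_cat p q x :
  snorm (p + q) x ^+ 2 = snorm p x ^+ 2 + snorm q (fun k => x (p + k)%N) ^+ 2.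
Proof. by rewrite !snorm_sq big_split_ord. Qed.

Lemma snorm_le p q x : (p <= q)%N -> snorm p x <= snorm q x.
Proof.
move=> pq; rewrite -(ler_pXn2r (n := 2))// ?nnegrE ?snorm_ge0//.
by rewrite -(subnKC pq) snorm_cat lerDl sqr_ge0.
Qed.

Lemma eq_snorm n x y : (forall k, (k < n)%N -> x k = y k) -> snorm n x = snorm n y.
Proof. by move=> xy; apply: eq_enorm => k; exact: xy. Qed.

Lemma snorm0 n : snorm n (fun=> 0) = 0.
Proof. exact: enorm0. Qed.

Lemma snorm_rev n x : snorm n (fun k => x (n.-1 - k)%N) = snorm n x.
Proof.
rewrite /snorm /enorm; congr Num.sqrt.
rewrite [RHS](reindex_inj rev_ord_inj) /=; apply: eq_bigr => k _.
by congr (normc (x _) ^+ 2); case: k => k /=; lia.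
Qed.

Lemma conv_cat b p q x i :
  conv b (p + q) x i = conv b p x i + \sum_(j < q) b (i%:Z - (p + j)%:Z) * x (p + j)%N.
Proof. by rewrite /conv big_split_ord. Qed.

(** A vanishing stretch of two band-widths decouples its two sides: their
    images have disjoint supports.  The left side sees the upper left corner of
    the section, that is the semi-infinite matrix; the right side, read
    backwards, sees the upper left corner of the transpose. *)
Lemma gap_below w b k p q y : banded w b -> 0 <= k ->
  (forall p x, k * snorm p x <= snorm (p + w) (conv b p x)) ->
  (forall p x, k * snorm p x <= snorm (p + w) (conv (reversed b) p x)) ->
  (forall j, (p <= j < p + (w + w))%N -> y j = 0) ->
  k * snorm (p + (w + w + q)) y <= snorm (p + (w + w + q)) (conv b (p + (w + w + q)) y).
Proof.
move=> bw k0 bb br y0.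
pose y' j := y (p + (w + w) + j)%N.
have convE i : conv b (p + (w + w + q)) y i =
    conv b p y i + \sum_(j < q) b (i%:Z - (p + (w + w) + j)%:Z) * y' j.
  rewrite addnA conv_cat conv_cat [X in _ + X + _]big1 ?addr0// => j _.
  by rewrite y0 ?mulr0// leq_addr ltn_add2l ltn_ord.
have low i : (i < p + w)%N -> conv b (p + (w + w + q)) y i = conv b p y i.
  move=> ip; rewrite convE big1 ?addr0// => j _.
  by rewrite bw ?mul0r//; lia.
have high i : conv b (p + (w + w + q)) y (p + w + i) =
    \sum_(j < q) b (i%:Z - w%:Z - j%:Z) * y' j.
  rewrite convE [X in X + _]big1 ?add0r => [|j _].
    by apply: eq_bigr => j _; congr (b _ * _); lia.
  by rewrite bw ?mul0r//; have := ltn_ord j; lia.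
rewrite -(ler_pXn2r (n := 2)) ?nnegrE ?mulr_ge0 ?snorm_ge0//.
rewrite exprMn.
have -> : (p + (w + w + q) = p + w + (w + q))%N by lia.
rewrite [in leRHS]snorm_cat.
have -> : snorm (p + w + (w + q)) y ^+ 2 = snorm p y ^+ 2 + snorm q y' ^+ 2.
  have -> : (p + w + (w + q) = p + (w + w) + q)%N by lia.
  rewrite snorm_cat snorm_cat.
  rewrite (@eq_snorm (w + w) _ (fun=> 0)) ?snorm0 ?expr0n ?addr0// => j jw.
  by rewrite y0// leq_addr ltn_add2l.
rewrite mulrDr; apply: lerD.
  rewrite -exprMn ler_pXn2r ?nnegrE ?mulr_ge0 ?snorm_ge0//.
  apply: le_trans (bb p y) _; rewrite le_eqVlt; apply/orP; left; apply/eqP.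
  apply: eq_snorm => i ip; rewrite -low//; congr (conv b _ y i); lia.
rewrite -exprMn ler_pXn2r ?nnegrE ?mulr_ge0 ?snorm_ge0//.
rewrite -(snorm_rev q y').
apply: le_trans (br q _) _; rewrite le_eqVlt; apply/orP; left; apply/eqP.
rewrite addnC -[in RHS]snorm_rev; apply: eq_snorm => i iq.
have -> : (p + w + (w + q) = p + (w + w + q))%N by lia.
rewrite high /conv.
rewrite [RHS](reindex_inj rev_ord_inj) /=; apply: eq_bigr => j _.
rewrite /reversed; congr (b _ * y' _); have := ltn_ord j; lia.
Qed.

Lemma snormD n x y : snorm n (fun k => x k + y k) <= snorm n x + snorm n y.
Proof. exact: enormD. Qed.

Lemma snormB n x y : snorm n x - snorm n y <= snorm n (fun k => x k - y k).
Proof. exact: enormB. Qed.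

Lemma convB b p x y i : conv b p (fun k => x k - y k) i = conv b p x i - conv b p y i.
Proof. by rewrite /conv -sumrB; apply: eq_bigr => j _; rewrite mulrBr. Qed.

(** Pigeonhole over [L] disjoint windows. *)
Lemma light_window W L x : (0 < L)%N -> exists2 l, (l < L)%N &
  L%:R * snorm W (fun k => x (l * W + k)%N) ^+ 2 <= snorm (L * W) x ^+ 2.
Proof.
move=> L0; pose m l := snorm W (fun k => x (l * W + k)%N) ^+ 2.
have -> : snorm (L * W) x ^+ 2 = \sum_(l < L) m l.
  elim: L {L0} => [|L IH]; first by rewrite mul0n big_ord0 snorm_sq big_ord0.
  by rewrite mulSnr snorm_cat IH big_ord_recr.
case: L L0 => // L _.
have [l _ lmin] := @arg_minP _ _ _ (@ord0 L) xpredT (fun l => m l) isT.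
exists l; first exact: ltn_ord.
rewrite -/(m l) mulr_natl.
have -> : m l *+ L.+1 = \sum_(j < L.+1) m l by rewrite sumr_const card_ord.
by apply: ler_sum => j _; exact: lmin.
Qed.

(** Cutting a vector at a window of small mass reduces a large section to the
    decoupled situation, at a cost that is independent of the size. *)
Lemma finite_section_below w b k : banded w b -> 0 <= k ->
  (forall p x, k * snorm p x <= snorm (p + w) (conv b p x)) ->
  (forall p x, k * snorm p x <= snorm (p + w) (conv (reversed b) p x)) ->
  forall d, 0 < d -> exists M0, forall M x, (M0 <= M)%N ->
    (k - d) * snorm M x <= snorm M (conv b M x).
Proof.
move=> bw k0 bb br d d0; set c := band_sum w b.
have c0 : 0 <= c by exact: band_sum_ge0.
(* With [L] windows the lightest one, [z], satisfies
   [(k + c) * snorm M z <= d * snorm M x]. *)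
pose L := (Num.bound ((k + c) ^+ 2 / d ^+ 2)).+1.
have Lk : (k + c) ^+ 2 <= d ^+ 2 * L%:R.
  rewrite mulrC -ler_pdivrMr ?exprn_gt0//.
  apply: (@le_trans _ _ (Num.bound ((k + c) ^+ 2 / d ^+ 2))%:R).
    by apply/ltW/archi_boundP; rewrite divr_ge0 ?sqr_ge0.
  by rewrite ler_nat.
exists (L * (w + w))%N => M x LM.
have [l lL wl] := light_window (w + w) x (ltn0Sn _ : (0 < L)%N).
pose p := (l * (w + w))%N.
have pM : (p + (w + w) <= M)%N.
  by apply: leq_trans LM; rewrite /p -mulSnr leq_mul2r lL orbT.
pose z j := if (p <= j < p + (w + w))%N then x j else 0.
have zsn : snorm M z = snorm (w + w) (fun j => x (p + j)%N).
  apply/eqP; rewrite -(eqrXn2 (n := 2)) ?snorm_ge0//; apply/eqP.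
  rewrite -(subnKC pM) snorm_cat snorm_cat.
  rewrite (@eq_snorm p z (fun=> 0)); last first.
    by move=> j jp; rewrite /z leqNgt jp.
  rewrite (@eq_snorm (M - _) _ (fun=> 0)); last first.
    by move=> j jp; rewrite /z ltnNge leq_addr andbF.
  rewrite !snorm0 expr0n add0r addr0; congr (_ ^+ 2).
  by apply: eq_snorm => j jw; rewrite /z leq_addr ltn_add2l jw.
have zd : (k + c) * snorm M z <= d * snorm M x.
  rewrite -(ler_pXn2r (n := 2)) ?nnegrE ?mulr_ge0 ?snorm_ge0 ?addr_ge0 ?(ltW d0)//.
  rewrite exprMn zsn; apply: (@le_trans _ _ (d ^+ 2 * L%:R *
     snorm (w + w) (fun j => x (p + j)%N) ^+ 2)).
    by rewrite ler_wpM2r ?sqr_ge0.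
  rewrite -mulrA exprMn ler_wpM2l ?sqr_ge0//; apply: le_trans wl _.
  by rewrite ler_pXn2r ?nnegrE ?snorm_ge0// snorm_le.
have yb : k * snorm M (fun j => x j - z j) <= snorm M (conv b M (fun j => x j - z j)).
  have := @gap_below w b k p (M - (p + (w + w))) (fun j => x j - z j) bw k0 bb br.
  have -> : (p + (w + w + (M - (p + (w + w)))) = M)%N by rewrite addnA subnKC.
  apply=> j jp.
  by rewrite /z jp subrr.
have s1 := snormB M x z.
have s2 : snorm M (conv b M (fun j => x j - z j)) <=
    snorm M (conv b M x) + c * snorm M z.
  apply: le_trans (lerD (lexx _) (conv_bounded M M z bw)).
  rewrite -[X in _ + X](enormN (fun i : 'I_M => conv b M z i)).
  rewrite (@eq_snorm M _ (fun i => conv b M x i + - conv b M z i)).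
    exact: enormD.
  by move=> i _; rewrite convB.
have s3 := ler_wpM2l k0 s1.
move: s2 s3 yb zd; rewrite mulrBr mulrBl mulrDl.
move: (snorm M (conv b M x)) (snorm M (conv b M (fun j => x j - z j))).
move: (k * _) (k * _) (c * _) (k * _) (d * _).
by clear => *; lra.
Qed.

Lemma mx_below_toeplitz b M k : mx_below (toeplitz b M) k <->
  forall x, k * snorm M x <= snorm M (conv b M x).
Proof.
split=> [Bk x|Bk v].
  have := Bk (\col_i x i); rewrite !norm2E.
  rewrite (@eq_enorm _ _ _ (fun i : 'I_M => x i)); last by move=> i; rewrite mxE.
  rewrite [X in _ <= X -> _](@eq_enorm _ _ _ (fun i : 'I_M => conv b M x i))//.
  by move=> i; rewrite mxE /conv; apply: eq_bigr => j _; rewrite !mxE.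
pose x j := oapp (fun i : 'I_M => v i 0) 0 (insub j).
have xE (i : 'I_M) : x i = v i 0 by rewrite /x valK.
have := Bk x; rewrite !norm2E.
rewrite (@eq_enorm _ _ _ (fun i : 'I_M => x i)); last by move=> i; rewrite xE.
rewrite [X in _ -> _ <= X](@eq_enorm _ _ _ (fun i : 'I_M => conv b M x i))//.
by move=> i; rewrite mxE /conv; apply: eq_bigr => j _; rewrite !mxE xE.
Qed.

End ToeplitzSections.

(** * Toeplitz operators on square-summable sequences *)

Section SequenceSpaceFacts.
Context {R : realType}.
Local Notation C := R[i].
Implicit Types (b : int -> C) (x y : nat -> C) (w p q M : nat)
  (T B : (nat -> C) -> nat -> C).

Lemma l2_seriesE x n : series (fun k => normc (x k) ^+ 2) n = snorm n x ^+ 2.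
Proof. by rewrite snorm_sq /series /= big_mkord. Qed.

Lemma l2_series_nd x : nondecreasing_seq (series (fun k => normc (x k) ^+ 2)).
Proof.
by move=> m n mn; rewrite !l2_seriesE ler_pXn2r ?nnegrE ?snorm_ge0 ?snorm_le.
Qed.

Lemma snorm_l2norm x n : in_l2 x -> snorm n x <= l2norm x.
Proof.
move=> xl2; rewrite /l2norm -[leLHS](ger0_norm (snorm_ge0 _ _)) -sqrtr_sqr.
rewrite ler_wsqrtr// -l2_seriesE; exact: nondecreasing_cvgn_le (l2_series_nd x) xl2 n.
Qed.

Lemma l2norm_ge0 x : 0 <= l2norm x.
Proof. exact: sqrtr_ge0. Qed.

(** Together with [snorm_l2norm] and [l2norm_le], this reduces statements on
    square-summable sequences to uniform bounds on initial segments. *)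
Lemma bounded_in_l2 x (K : R) : (forall n, snorm n x <= K) -> in_l2 x.
Proof.
move=> xK; apply: nondecreasing_is_cvgn; first exact: l2_series_nd.
exists (K ^+ 2) => _ [n _ <-]; rewrite l2_seriesE ler_pXn2r ?nnegrE ?snorm_ge0//.
exact: le_trans (snorm_ge0 n x) (xK n).
Qed.

Lemma l2norm_le x (K : R) : (forall n, snorm n x <= K) -> l2norm x <= K.
Proof.
move=> xK; have K0 := le_trans (snorm_ge0 0 x) (xK 0%N).
rewrite -[leRHS](ger0_norm K0) -sqrtr_sqr /l2norm ler_wsqrtr//.
apply: limr_le; first exact: bounded_in_l2 xK.
by apply: nearW => n; rewrite l2_seriesE ler_pXn2r ?nnegrE ?snorm_ge0.
Qed.

Lemma snormZ n (c : C) x : snorm n (fun k => c * x k) = normc c * snorm n x.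
Proof. exact: enormZ. Qed.

Lemma in_l2_lin (c : C) x y : in_l2 x -> in_l2 y -> in_l2 (fun k => c * x k + y k).
Proof.
move=> xl yl; apply: (@bounded_in_l2 _ (normc c * l2norm x + l2norm y)) => n.
apply: le_trans (snormD _ _ _) _; apply: lerD; last exact: snorm_l2norm.
by rewrite snormZ ler_wpM2l ?normc_ge0// snorm_l2norm.
Qed.

Lemma in_l20 : in_l2 (fun=> 0 : C).
Proof. by apply: (@bounded_in_l2 _ 0) => n; rewrite snorm0. Qed.

Lemma l2norm0 : l2norm (fun=> 0 : C) = 0.
Proof. by apply/eqP; rewrite eq_le l2norm_ge0 andbT; apply: l2norm_le => n; rewrite snorm0. Qed.

Lemma l2norm_eq0 x : in_l2 x -> l2norm x = 0 -> x = fun=> 0.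
Proof.
move=> xl x0; apply/funext => k.
have /enorm0_eq0/(_ ord_max) : snorm k.+1 x = 0.
  by apply/eqP; rewrite eq_le snorm_ge0 andbT -x0 snorm_l2norm.
by [].
Qed.

Lemma l2_opnorm_ub T : l2_bounded_op T ->
  has_ubound [set l2norm (T x) | x in [set x | in_l2 x /\ l2norm x <= 1]].
Proof.
move=> [_ _ [K TK]]; exists `|K| => _ [z [zl z1] <-]; apply: le_trans (TK z zl) _.
apply: (@le_trans _ _ (`|K| * l2norm z)); first by rewrite ler_wpM2r ?l2norm_ge0// ler_norm.
by rewrite -[leRHS]mulr1 ler_wpM2l.
Qed.

Lemma l2_opnorm_ge0 T : l2_bounded_op T -> 0 <= l2_opnorm T.
Proof.
move=> Tb; apply: (@le_trans _ _ (l2norm (T (fun=> 0)))); first exact: l2norm_ge0.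
apply: ub_le_sup; first exact: l2_opnorm_ub.
by exists (fun=> 0) => //; split; [exact: in_l20|rewrite l2norm0 ler01].
Qed.

Lemma l2_opnorm_le T x : l2_bounded_op T -> in_l2 x ->
  l2norm (T x) <= l2_opnorm T * l2norm x.
Proof.
move=> [Tl Tlin [K TK]] xl.
have T0 : T (fun=> 0) = fun=> 0.
  have := Tlin 1 _ _ in_l20 in_l20.
  rewrite (_ : (fun=> 1 * 0 + 0) = fun=> 0); last by apply/funext => k; rewrite mulr0 addr0.
  move=> TE; apply/funext => k; move/(congr1 (@^~ k)) : TE.
  by rewrite mul1r -[LHS]addr0 => /addrI.
have [x0|x0] := eqVneq (l2norm x) 0.
  by rewrite (l2norm_eq0 xl x0) T0 l2norm0 mulr0.
have xp : 0 < l2norm x by rewrite lt_neqAle eq_sym x0 l2norm_ge0.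
have cE n (z : nat -> C) : snorm n (fun k => (l2norm x)^-1%:C * z k) = (l2norm x)^-1 * snorm n z.
  by rewrite snormZ normc_re ger0_norm// invr_ge0 l2norm_ge0.
set x' := fun k => (l2norm x)^-1%:C * x k.
have x'1 n : snorm n x' <= 1.
  by rewrite cE mulrC ler_pdivrMr// mul1r snorm_l2norm.
have Tx' : T x' = fun k => (l2norm x)^-1%:C * T x k.
  have := Tlin (l2norm x)^-1%:C x _ xl in_l20; rewrite T0.
  under eq_fun do rewrite addr0.
  by under [X in _ = X -> _]eq_fun do rewrite addr0.
apply: (@le_trans _ _ (l2norm (T x') * l2norm x)).
  apply: l2norm_le => n; rewrite -ler_pdivrMr// mulrC -cE -Tx'.
  by apply: snorm_l2norm; apply: Tl; exact: bounded_in_l2 x'1.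
rewrite ler_wpM2r ?l2norm_ge0//; apply: ub_le_sup.
  by apply: l2_opnorm_ub; split=> //; exists K.
by exists x' => //; split; [exact: bounded_in_l2 x'1|exact: l2norm_le].
Qed.

Lemma conv_widen w b p q x i : banded w b -> (i + w < p)%N -> (p <= q)%N ->
  conv b q x i = conv b p x i.
Proof.
move=> bw ip pq; rewrite -(subnKC pq) conv_cat big1 ?addr0// => j _.
by rewrite bw ?mul0r//; lia.
Qed.

Lemma toeplitz_op_conv w b p x i : banded w b -> (i + w < p)%N ->
  toeplitz_op b w x i = conv b p x i.
Proof. by move=> bw ip; rewrite (@conv_widen w b (i + w.+1))// ?addnS. Qed.

Definition trunc p x : nat -> C := fun k => if (k < p)%N then x k else 0.

Lemma snorm_trunc p x n : snorm n (trunc p x) <= snorm p x.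
Proof.
rewrite -(@eq_snorm _ p (trunc p x)) => [|k kp]; last by rewrite /trunc kp.
have [np|pn] := leqP n p; first exact: snorm_le.
rewrite -(ler_pXn2r (n := 2))// ?nnegrE ?snorm_ge0//.
rewrite -(subnKC (ltnW pn)) snorm_cat [X in _ + X ^+ 2](_ : _ = 0).
  by rewrite expr0n addr0.
by rewrite -(@snorm0 R (n - p)); apply: eq_snorm => k _; rewrite /trunc ltnNge leq_addr.
Qed.

Lemma toeplitz_op_trunc w b p x : banded w b ->
  toeplitz_op b w (trunc p x) = trunc (p + w) (conv b p x).
Proof.
move=> bw; apply/funext => i.
have E q y : (forall j, (p <= j)%N -> y j = 0) -> (p <= q)%N -> conv b q y i = conv b p y i.
  move=> y0 pq; rewrite -(subnKC pq) conv_cat big1 ?addr0// => j _.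
  by rewrite y0 ?mulr0// leq_addr.
have t0 j : (p <= j)%N -> trunc p x j = 0 by rewrite /trunc ltnNge => ->.
rewrite (@toeplitz_op_conv w b (p + i + w).+1)//; last by lia.
rewrite E//; last by lia.
have -> : conv b p (trunc p x) i = conv b p x i.
  by apply: eq_bigr => j _; rewrite /trunc ltn_ord.
rewrite [RHS]/trunc; case: ltnP => // pi; apply: big1 => j _.
by rewrite bw ?mul0r//; have := ltn_ord j; lia.
Qed.

Lemma in_l2_trunc p x : in_l2 (trunc p x).
Proof. exact: bounded_in_l2 (snorm_trunc p x). Qed.
Arguments in_l2_trunc : clear implicits.

Lemma op_below w b B p x : banded w b -> l2_inverse (toeplitz_op b w) B ->
  snorm p x <= l2_opnorm B * snorm (p + w) (conv b p x).
Proof.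
move=> bw [Bb Binv].
have B0 := l2_opnorm_ge0 Bb.
have [BT _] := Binv _ (in_l2_trunc p x).
rewrite -(@eq_snorm _ p (trunc p x)) => [|k kp]; last by rewrite /trunc kp.
apply: le_trans (snorm_l2norm p (in_l2_trunc p x)) _.
rewrite -{1}BT toeplitz_op_trunc//.
apply: le_trans (l2_opnorm_le Bb (in_l2_trunc _ _)) _.
by rewrite ler_wpM2l//; apply: l2norm_le; exact: snorm_trunc.
Qed.

(** Although only the operator itself is inverted, its transpose inherits the
    same lower bound on finite vectors by duality: solve for the conjugate of
    [x] and move the matrix to the other side of the pairing.  All sums are
    finite because of the band structure. *)
Lemma op_below_reversed w b B p x : banded w b -> l2_inverse (toeplitz_op b w) B ->
  snorm p x <= l2_opnorm B * snorm (p + w) (conv (reversed b) p x).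
Proof.
move=> bw [Bb Binv]; set g := conv _ p x; set s := snorm p x.
have [_ TB] := Binv _ (in_l2_trunc p (fun k => (x k)^*)).
set v := B _ in TB.
have B0 := l2_opnorm_ge0 Bb.
have vs : l2norm v <= l2_opnorm B * s.
  apply: le_trans (l2_opnorm_le Bb (in_l2_trunc _ _)) _; rewrite ler_wpM2l//.
  apply: l2norm_le => n; apply: le_trans (snorm_trunc _ _ _) _.
  by rewrite /s /snorm /enorm; under eq_bigr do rewrite normc_conj.
have vl : in_l2 v by case: Bb => Bl _ _; apply: Bl; exact: in_l2_trunc.
have ss : s * s <= snorm (p + w) g * l2norm v.
  have sE : (s * s)%:C = \sum_(j < p + w) g j * v j.
    transitivity (\sum_(i < p) x i * conv b (p + w) v i).
      rewrite -expr2 snorm_sq rmorph_sum; apply: eq_bigr => i _.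
      rewrite -(@toeplitz_op_conv w)//; last by rewrite ltn_add2r.
      by rewrite TB /trunc ltn_ord rmorphXn /= -normc_real sqr_normc.
    under eq_bigr do rewrite /conv mulr_sumr.
    rewrite exchange_big /=; apply: eq_bigr => j _.
    rewrite /g /conv mulr_suml; apply: eq_bigr => i _.
    by rewrite /reversed opprB mulrA [_ * x i]mulrC.
  have : normc ((s * s)%:C : C) <= snorm (p + w) g * snorm (p + w) v.
    rewrite sE; apply: le_trans (normc_sum _ _) _.
    rewrite -(ler_pXn2r (n := 2)) ?nnegrE ?mulr_ge0 ?snorm_ge0//; last first.
      by apply: sumr_ge0 => *; exact: normc_ge0.
    rewrite exprMn !snorm_sq; under eq_bigr do rewrite normcM.
    exact: sum_cauchy_schwarz.
  rewrite normc_re ger0_norm ?mulr_ge0 ?snorm_ge0// => /le_trans; apply.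
  by rewrite ler_wpM2l ?snorm_ge0// snorm_l2norm.
have [s0|s0] := leP s 0.
  by apply: le_trans s0 _; rewrite mulr_ge0 ?snorm_ge0.
rewrite -(ler_pM2l s0); apply: le_trans ss _.
by rewrite [leRHS]mulrCA mulrA [leRHS]mulrC ler_wpM2l ?snorm_ge0.
Qed.

End SequenceSpaceFacts.

(** * Invertibility of the operator from its sections *)

Section LimitsAlongUltrafilters.
Context {R : realType}.
Local Notation C := R[i].
Implicit Types (b : int -> C) (x y : nat -> C) (w p q M : nat).

Variable U : set_system nat.
Hypothesis UU : UltraFilter U.

(** Convergence of the real and imaginary parts separately, so that only the
    topology of the reals is involved. *)
Definition cvgc (u : nat -> C) (l : C) :=
  (fun n => complex.Re (u n)) @ U --> complex.Re l /\
  (fun n => complex.Im (u n)) @ U --> complex.Im l.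

Lemma cvgc_cst (l : C) : cvgc (fun=> l) l.
Proof. by split; exact: cvg_cst. Qed.

Lemma cvgcD u v (l m : C) : cvgc u l -> cvgc v m -> cvgc (fun n => u n + v n) (l + m).
Proof.
move=> [ul1 ul2] [vl1 vl2]; split.
  have -> : complex.Re (l + m) = complex.Re l + complex.Re m by case: (l) (m) => ? ? [].
  rewrite (_ : (fun n => _) = (fun n => complex.Re (u n) + complex.Re (v n))).
    exact: cvgD.
  by apply/funext => n; case: (u n) (v n) => ? ? [].
have -> : complex.Im (l + m) = complex.Im l + complex.Im m by case: (l) (m) => ? ? [].
rewrite (_ : (fun n => _) = (fun n => complex.Im (u n) + complex.Im (v n))).
  exact: cvgD.
by apply/funext => n; case: (u n) (v n) => ? ? [].
Qed.

Lemma cvgcZ c u (l : C) : cvgc u l -> cvgc (fun n => c * u n) (c * l).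
Proof.
case: c l => [c d] [l m] [ul1 ul2]; split => /=.
  rewrite (_ : (fun n => _) = (fun n => c * complex.Re (u n) - d * complex.Im (u n))).
    by apply: cvgB; exact: cvgMr.
  by apply/funext => n; case: (u n).
rewrite (_ : (fun n => _) = (fun n => c * complex.Im (u n) + d * complex.Re (u n))).
  by apply: cvgD; exact: cvgMr.
by apply/funext => n; case: (u n).
Qed.

Lemma cvgc_unique u (l m : C) : cvgc u l -> cvgc u m -> l = m.
Proof.
case: l m => [l l'] [m m'] [/= a b] [/= c d].
by congr (_ +i* _); [exact: (cvg_unique _ a c)|exact: (cvg_unique _ b d)].
Qed.

Lemma cvgc_near u v (l : C) : (\forall n \near U, u n = v n) -> cvgc u l -> cvgc v l.
Proof.
move=> uv [a b]; split.
  by apply: cvg_trans a; apply: near_eq_cvg; near=> n; congr complex.Re; near: n.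
by apply: cvg_trans b; apply: near_eq_cvg; near=> n; congr complex.Im; near: n.
Unshelve. all: by end_near. Qed.

Lemma cvgc_conv b p (X : nat -> nat -> C) x i :
  (forall k, cvgc (fun n => X n k) (x k)) ->
  cvgc (fun n => conv b p (X n) i) (conv b p x i).
Proof.
move=> Xx; elim: p => [|p IH].
  by rewrite /conv big_ord0; under eq_fun do rewrite big_ord0; exact: cvgc_cst.
rewrite /conv big_ord_recr /=; under eq_fun do rewrite big_ord_recr /=.
by apply: cvgcD => //; exact: cvgcZ.
Qed.

Lemma ultra_pushforward (V : Type) (f : nat -> V) : UltraFilter (f @ U).
Proof.
split=> [|G GF UG]; first exact: fmap_proper_filter.
apply/seteqP; split=> // B GB; have [//|nB] := in_ultra_setVsetC (f @^-1` B) UU.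
have /UG GnB : (f @ U) (~` B) by [].
by have [v []] := filter_ex (filterI GB GnB).
Qed.

Lemma ultra_cvg_real (u : nat -> R) (K : R) : (forall n, `|u n| <= K) ->
  exists l : R, u @ U --> l.
Proof.
move=> uK; have := @segment_compact R (- K) K; rewrite compact_ultra.
move=> /(_ (u @ U) (ultra_pushforward u)); case.
  have inK n : u n \in `[- K, K] by rewrite in_itv /= -ler_norml.
  by apply: (@filterS _ U _ setT _ (fun n _ => inK n)); exact: filterT.
by move=> l [_ ul]; exists l.
Qed.

Lemma ultra_cvgc (u : nat -> C) (K : R) : (forall n, normc (u n) <= K) ->
  exists l : C, cvgc u l.
Proof.
move=> uK.
have part (f : C -> R) : (forall z, f z ^+ 2 <= normc z ^+ 2) ->
    exists l : R, (fun n => f (u n)) @ U --> l.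
  move=> fz; apply: (@ultra_cvg_real _ K) => n; apply: le_trans (uK n).
  rewrite -(ler_pXn2r (n := 2)) ?nnegrE ?normc_ge0//.
  by rewrite real_normK ?num_real.
have [l1 ul1] : exists l : R, (fun n => complex.Re (u n)) @ U --> l.
  by apply: (part (@complex.Re R)) => z; rewrite sqr_normcE lerDl sqr_ge0.
have [l2 ul2] : exists l : R, (fun n => complex.Im (u n)) @ U --> l.
  by apply: (part (@complex.Im R)) => z; rewrite sqr_normcE lerDr sqr_ge0.
by exists (l1 +i* l2); split.
Qed.

Lemma cvgc_snorm p (X : nat -> nat -> C) x (K : R) : 0 <= K ->
  (forall k, cvgc (fun n => X n k) (x k)) ->
  (forall n, snorm p (X n) <= K) -> snorm p x <= K.
Proof.
move=> K0 Xx XK; rewrite -(ler_pXn2r (n := 2)) ?nnegrE ?snorm_ge0//.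
have lim : (fun n => snorm p (X n) ^+ 2) @ U --> snorm p x ^+ 2.
  elim: p {XK} => [|p IH].
    rewrite snorm_sq big_ord0; under eq_fun do rewrite snorm_sq big_ord0.
    exact: cvg_cst.
  rewrite snorm_sq big_ord_recr /= -snorm_sq.
  under eq_fun do rewrite snorm_sq big_ord_recr /= -snorm_sq.
  apply: cvgD => //; rewrite sqr_normcE; under eq_fun do rewrite sqr_normcE.
  have [a b] := Xx p.
  by apply: cvgD; rewrite expr2; under eq_fun do rewrite expr2; exact: cvgM.
apply: (closed_cvg (fun r : R => r <= K ^+ 2)) lim; first exact: closed_le.
by apply: nearW => n; rewrite ler_pXn2r ?nnegrE ?snorm_ge0.
Qed.

End LimitsAlongUltrafilters.

Section InvertibleFromSections.
Context {R : realType}.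
Local Notation C := R[i].
Implicit Types (b : int -> C) (x y : nat -> C) (w p q M : nat).
Variables (w : nat) (b : int -> C) (k : R).
Hypothesis bw : banded w b.
Hypothesis k0 : 0 < k.
Hypothesis sections_below : forall M0, exists2 M, (M0 <= M)%N &
  forall x, k * snorm M x <= snorm M (conv b M x).

Let T := toeplitz_op b w.

(** The image of a kernel vector under the [M]-th section is minus the
    contribution of the entries cut off by the section, and only those in a
    window of length [w] after [M] contribute; a
    uniform lower bound would then keep the mass of the first [M] entries away
    from the total mass. *)
Lemma op_injective x : in_l2 x -> T x = (fun=> 0) -> x = fun=> 0.
Proof.
move=> xl Tx; apply: l2norm_eq0 => //.
set c := band_sum w b; have c0 : 0 <= c by exact: band_sum_ge0.
set s := l2norm x.
have s0 : 0 <= s by exact: l2norm_ge0.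
have key M : (forall x, k * snorm M x <= snorm M (conv b M x)) ->
    k ^+ 2 * snorm M x ^+ 2 <= c ^+ 2 * (s ^+ 2 - snorm M x ^+ 2).
  move=> Mb; pose z j := if (j < M)%N then 0 else x j.
  have E i : (i < M)%N -> conv b M x i = - conv b (M + w) z i.
    move=> iM; have := congr1 (@^~ i) Tx; rewrite /= /T.
    rewrite (@toeplitz_op_conv _ w b (M + w))//; last first.
      by rewrite ltn_add2r.
    rewrite conv_cat => /eqP; rewrite addr_eq0 => /eqP ->; congr (- _).
    rewrite conv_cat [X in _ = X + _]big1 ?add0r => [|j _]; last by rewrite /z ltn_ord mulr0.
    by apply: eq_bigr => j _; rewrite /z ltnNge leq_addr.
  have : k * snorm M x <= c * snorm (M + w) z.
    apply: le_trans (Mb x) _; apply: le_trans (conv_bounded (M + w) (M + w) z bw).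
    rewrite (eq_snorm (y := fun i => - conv b (M + w) z i))//.
    rewrite /snorm enormN; exact: (snorm_le _ (leq_addr w M)).
  rewrite -(ler_pXn2r (n := 2)) ?nnegrE ?mulr_ge0 ?snorm_ge0 ?(ltW k0)//.
  rewrite !exprMn => /le_trans; apply; rewrite ler_wpM2l ?sqr_ge0//.
  rewrite lerBrDl snorm_cat (@eq_snorm _ M z (fun=> 0)); last by move=> j jM; rewrite /z jM.
  rewrite snorm0 expr0n add0r (@eq_snorm _ w _ (fun j => x (M + j)%N)); last first.
    by move=> j _; rewrite /z ltnNge leq_addr.
  by rewrite -snorm_cat ler_pXn2r ?nnegrE ?snorm_ge0// snorm_l2norm.
apply/eqP; rewrite eq_le s0 andbT leNgt; apply/negP => sp.
have kc : 0 < k ^+ 2 + c ^+ 2 by rewrite ltr_pwDl ?exprn_gt0 ?sqr_ge0.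
(* The bound on the squared [M]-th partial norm obtained by solving [key]
   for it; it is strictly below the full squared norm [s ^+ 2]. *)
pose K2 := s ^+ 2 * (c ^+ 2 / (k ^+ 2 + c ^+ 2)).
have big M : (forall x, k * snorm M x <= snorm M (conv b M x)) -> snorm M x ^+ 2 <= K2.
  move=> /key; rewrite /K2 mulrBr lerBrDr -mulrDl mulrA ler_pdivlMr// => h.
  by rewrite mulrC (mulrC (s ^+ 2)).
have all n : snorm n x <= Num.sqrt K2.
  have [M nM /big h] := sections_below n.
  apply: le_trans (snorm_le _ nM) _; rewrite -[leLHS](ger0_norm (snorm_ge0 _ _)).
  by rewrite -sqrtr_sqr ler_wsqrtr.
have := l2norm_le all; rewrite -/s.
have K20 : 0 <= K2 by rewrite mulr_ge0 ?divr_ge0 ?sqr_ge0 ?(ltW kc).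
rewrite -(ler_pXn2r (n := 2)) ?nnegrE ?sqrtr_ge0// (sqr_sqrtr K20).
rewrite /K2 ler_pMr ?exprn_gt0// ler_pdivlMr// mul1r.
by rewrite gerDr leNgt exprn_gt0.
Qed.

Lemma section_solution M y : (forall x, k * snorm M x <= snorm M (conv b M x)) ->
  exists x, (forall i, (i < M)%N -> conv b M x i = y i) /\
            forall p, snorm p x <= k^-1 * snorm M y.
Proof.
move=> Mb; have Bb : mx_below (toeplitz b M) k by apply/mx_below_toeplitz.
pose v : 'cV[C]_M := \col_i y i; pose u := invmx (toeplitz b M) *m v.
pose x j := oapp (fun i : 'I_M => u i 0) 0 (insub j).
have xE (i : 'I_M) : x i = u i 0 by rewrite /x valK.
exists x; split=> [i iM|p].
  have /matrixP/(_ (Ordinal iM) 0) : toeplitz b M *m u = v.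
    by rewrite mulKVmx// (mx_below_unit k0 Bb).
  rewrite mxE [RHS]mxE => <-; apply: eq_bigr => j _.
  by rewrite xE; congr (_ * _); rewrite mxE.
have -> : snorm M y = norm2 v.
  by rewrite norm2E; apply: eq_enorm => i; rewrite mxE.
apply: le_trans (mx_below_inv k0 Bb v); rewrite -/u.
have <- : snorm M x = norm2 u by rewrite norm2E; apply: eq_enorm => i; rewrite xE.
rewrite -[leLHS](@eq_snorm _ _ (trunc M x)) ?snorm_trunc// => j _.
by rewrite /trunc; case: ltnP => // Mj; rewrite /x insubF// ltnNge Mj.
Qed.

(** The solutions of the finite sections are bounded, hence converge entrywise
    along an ultrafilter; every row of the matrix is finite, so the limit
    solves the full equation. *)
Lemma op_solution y : in_l2 y ->
  exists x, [/\ in_l2 x, T x = y & l2norm x <= k^-1 * l2norm y].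
Proof.
move=> yl; have K0 : 0 <= k^-1 * l2norm y by rewrite mulr_ge0 ?l2norm_ge0 ?invr_ge0 ?ltW.
have /choice[X XP] : forall n : nat, exists x,
    (forall i, (i + w < n)%N -> T x i = y i) /\ forall p, snorm p x <= k^-1 * l2norm y.
  move=> n; have [M nM Mb] := sections_below n; have [x [xs xb]] := section_solution y Mb.
  exists x; split=> [i iM|p].
    have iM' := leq_trans iM nM.
    rewrite /T (@toeplitz_op_conv _ w b M)// xs//; lia.
  apply: le_trans (xb p) _; rewrite ler_wpM2l ?invr_ge0 ?(ltW k0)//; exact: snorm_l2norm.
have [U [UU FU]] := ultraFilterLemma (F := \oo) _.
have /choice[x Xx] : forall j, exists l, cvgc U (fun n => X n j) l.
  move=> j; apply: (@ultra_cvgc _ _ _ _ (k^-1 * l2norm y)) => n.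
  apply: le_trans (proj2 (XP n) j.+1).
  rewrite -(ler_pXn2r (n := 2)) ?nnegrE ?snorm_ge0 ?normc_ge0//.
  rewrite snorm_sq big_ord_recr /= lerDr; exact: sumsq_ge0.
have xK p : snorm p x <= k^-1 * l2norm y.
  by apply: (cvgc_snorm UU K0 Xx) => n; exact: (proj2 (XP n)).
exists x; split; [exact: bounded_in_l2 xK| |exact: l2norm_le].
apply/funext => i.
apply: (cvgc_unique UU (u := fun n => T (X n) i)).
  by rewrite /T /toeplitz_op; exact: cvgc_conv.
apply: cvgc_near (cvgc_cst UU (y i)).
by apply: FU; exists (i + w).+1 => // n /= iwn; rewrite (proj1 (XP n)).
Qed.

(** Stability of infinitely many sections makes the operator invertible, with
    the same constant. *)
Lemma op_invnormV_ge : k <= l2_invnormV T.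
Proof.
have Tlin (c : C) x y : T (fun j => c * x j + y j) = (fun j => c * T x j + T y j).
  apply/funext => i; rewrite /T /toeplitz_op mulr_sumr -big_split /=.
  by apply: eq_bigr => j _; rewrite mulrDr mulrCA.
have Tl2 x : in_l2 x -> in_l2 (T x).
  move=> xl; apply: (@bounded_in_l2 _ _ (band_sum w b * l2norm x)) => n.
  rewrite (@eq_snorm _ n _ (conv b (n + w) x)) => [|i ni]; last first.
    by rewrite /T (@toeplitz_op_conv _ w b (n + w))// ltn_add2r.
  apply: le_trans (conv_bounded _ _ _ bw) _.
  by rewrite ler_wpM2l ?band_sum_ge0// snorm_l2norm.
have uniq x y : in_l2 x -> in_l2 y -> T x = T y -> x = y.
  move=> xl yl xy; have d0 : (fun j => -1 * y j + x j) = fun=> 0 :> C.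
    apply: op_injective; first exact: in_l2_lin.
    by rewrite Tlin xy; apply/funext => j; rewrite mulN1r addNr.
  by apply/funext => j; move/(congr1 (@^~ j)) : d0 => /eqP; rewrite mulN1r addrC subr_eq0 => /eqP.
have /choice[B BP] : forall y, exists x, in_l2 y ->
    [/\ in_l2 x, T x = y & l2norm x <= k^-1 * l2norm y].
  move=> y; have [yl|yl] := pselect (in_l2 y); last by exists y.
  by have [x xP] := op_solution yl; exists x.
have Binv : l2_inverse T B.
  split.
    split=> [x /BP[]//|c x y xl yl|].
      have [Bx TBx _] := BP _ xl; have [By TBy _] := BP _ yl.
      have [Bxy TBxy _] := BP _ (@in_l2_lin _ c _ _ xl yl).
      by apply: uniq => //; [exact: in_l2_lin|rewrite TBxy Tlin TBx TBy].
    by exists k^-1 => x /BP[].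
  move=> x xl; split; last by have [] := BP _ xl.
  by have [? ? _] := BP _ (Tl2 x xl); exact: uniq.
rewrite /l2_invnormV; case: pselect => [ex|[]]; last by exists B.
case: (cid ex) => /= B' [Bb Binv'].
have B'le y : in_l2 y -> l2norm (B' y) <= k^-1 * l2norm y.
  move=> yl; have [_ TB] := Binv' _ yl; have [xl Tx xle] := BP _ yl.
  by rewrite (uniq (B' y) (B y)) ?Tx//; case: Bb => + _ _; exact.
have e1 : in_l2 (trunc 1 (fun=> 1 : C)) by exact: in_l2_trunc.
(* The inverse chosen by the definition is nonzero, since it must recover the
   first unit vector. *)
have o0 : 0 < l2_opnorm B'.
  rewrite lt_neqAle l2_opnorm_ge0// andbT; apply/eqP => o0.
  have := l2_opnorm_le Bb (Tl2 _ e1); rewrite -o0 mul0r.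
  have [-> _] := Binv' _ e1.
  have s1 : snorm 1 (trunc 1 (fun=> 1 : C)) = 1.
    rewrite /snorm /enorm big_ord1 (_ : trunc 1 _ _ = 1) //.
    by rewrite [normc _]normc1 expr1n sqrtr1.
  have := snorm_l2norm 1 e1; rewrite s1.
  by move=> h /(le_trans h); rewrite ler10.
rewrite -[k]invrK lef_pV2 ?posrE ?invr_gt0//.
apply: ge_sup.
  exists (l2norm (B' (fun=> 0))), (fun=> 0) => //.
  by split; [exact: in_l20|rewrite l2norm0 ler01].
move=> _ [z [zl z1] <-]; apply: le_trans (B'le z zl) _.
by rewrite -[leRHS]mulr1 ler_wpM2l ?invr_ge0 ?(ltW k0).
Qed.

End InvertibleFromSections.

(** * Convergence of the pseudospectra of the sections *)

Section SpectralLimits.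
Context {R : realType}.
Local Notation C := R[i].
Implicit Types (a b : int -> C) (w n M : nat).

Lemma mx_below_sub_scalar n (E : 'M[C]_n) k z : mx_below E k ->
  mx_below (E - z%:M) (k - normc z).
Proof.
move=> Ek x; rewrite mulrBl mulmxBl mul_scalar_mx.
by apply: le_trans (norm2B _ _); rewrite norm2Z lerD2r.
Qed.

(** Compactness of discs: a threshold that can be chosen locally can be chosen
    uniformly on bounded sets. *)
Lemma locally_uniform (Q : nat -> C -> Prop) :
  (forall mu, exists2 r : R, 0 < r & exists n0, forall n, (n0 <= n)%N ->
     forall l, normc (l - mu) < r -> Q n l) ->
  forall K : R, exists n0, forall n, (n0 <= n)%N -> forall l, normc l <= K -> Q n l.
Proof.
move=> loc K.
have cpt : compact (`[- K, K]%classic `*` `[- K, K]%classic : set (R * R)).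
  by apply: compact_setX; exact: segment_compact.
have /compact_near_coveringP/(_ nat \oo (fun n u => Q n (u.1 +i* u.2)) _) := cpt.
case.
  move=> [s t] _; have [r r0 [n0 h]] := loc (s +i* t).
  exists (ball (s, t) (r / 2), [set n | (n0 <= n)%N]).
    by split; [apply: nbhsx_ballx; rewrite divr_gt0|exists n0].
  move=> [[s' t'] n] [[/= ss tt] n0n]; apply: h => //=.
  move: ss tt; rewrite /ball /= => ss tt.
  apply: (@le_lt_trans _ _ (`|s - s'| + `|t - t'|)); last first.
    by rewrite (splitr r) ltrD.
  rewrite -(ler_pXn2r (n := 2)) ?nnegrE ?sqrtr_ge0 ?addr_ge0//.
  rewrite sqr_sqrtr ?addr_ge0 ?sqr_ge0// -(real_normK (num_real (s' - s))).
  rewrite -(real_normK (num_real (t' - t))) (distrC s') (distrC t') sqrrD.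
  by rewrite lerD2r lerDl mulrn_wge0// mulr_ge0.
move=> n0 _ h; exists n0 => n n0n [s t] stK; apply: (h n n0n (s, t)).
have le (f : C -> R) : (forall z, f z ^+ 2 <= normc z ^+ 2) -> `|f (s +i* t)| <= K.
  move=> fz; apply: le_trans stK.
  rewrite -(ler_pXn2r (n := 2)) ?nnegrE ?normc_ge0//.
  by rewrite real_normK ?num_real.
split; rewrite /= in_itv /= -ler_norml.
  by apply: (le (@complex.Re R)) => z; rewrite sqr_normcE lerDl sqr_ge0.
by apply: (le (@complex.Im R)) => z; rewrite sqr_normcE lerDr sqr_ge0.
Qed.

Lemma mx_pspec_le a w e M l : banded w a -> (0 < M)%N -> 0 <= e ->
  mx_pspec e (toeplitz a M) l -> normc l <= band_sum w a + e.
Proof.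
move=> aw M0 e0 le; rewrite leNgt; apply/negP => lt.
suff : ~ mx_pspec e (toeplitz a M) l by [].
apply/not_mx_pspecP => //; exists (normc l - band_sum w a); first by rewrite ltrBrDl.
rewrite toeplitz_shifted; apply/mx_below_toeplitz => x.
have -> : snorm M (conv (shifted a l) M x) = snorm M (fun i => l * x i - conv a M x i).
  transitivity (snorm M (fun i => - (l * x i - conv a M x i))); last exact: enormN.
  by apply: eq_snorm => i iM; rewrite opprB conv_shifted.
apply: le_trans (snormB _ _ _); rewrite snormZ mulrBl lerD2l lerN2.
exact: conv_bounded.
Qed.

Lemma l2_invnormV_gt0 (T : (nat -> C) -> nat -> C) : 0 < l2_invnormV T ->
  exists2 B, l2_inverse T B & l2_invnormV T = (l2_opnorm B)^-1.
Proof.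
rewrite /l2_invnormV; case: pselect => [ex|]; last by rewrite ltxx.
by case: (cid ex) => B BP /= _; exists B.
Qed.

(** Off the pseudospectrum of the operator, large sections stay uniformly
    invertible with nearly the same constant. *)
Lemma resolvent_section_stable a w eps mu : banded w a -> 0 <= eps ->
  ~ l2_pspec eps (toeplitz_op a w) mu ->
  exists2 r, 0 < r & exists M0, forall M, (M0 <= M)%N -> (0 < M)%N ->
    forall l, normc (l - mu) < r -> ~ mx_pspec (eps + r) (toeplitz a M) l.
Proof.
move=> aw e0 /negP; rewrite -ltNge toeplitz_op_shifted.
set b := shifted a mu; set k := l2_invnormV _ => ek.
have k0 : 0 < k by exact: le_lt_trans ek.
have bw : banded w b by exact: banded_shifted.
have [B BP kE] := l2_invnormV_gt0 k0.
have o0 : 0 < l2_opnorm B by rewrite -invr_gt0 -kE.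
pose r := (k - eps) / 4.
have r0 : 0 < r by rewrite divr_gt0 ?subr_gt0.
have [||M0 MB] := finite_section_below bw (ltW k0) _ _ r0.
- by move=> p x; rewrite /k kE mulrC ler_pdivrMr// mulrC; exact: op_below BP.
- by move=> p x; rewrite /k kE mulrC ler_pdivrMr// mulrC; exact: op_below_reversed BP.
exists r => //; exists M0 => M M0M Mp l lmu.
apply/not_mx_pspecP; rewrite ?addr_ge0 ?(ltW r0)//.
exists (k - r - normc (l - mu)).
  have kr : k = eps + 4 * r by rewrite /r; field.
  by move: kr lmu r0; move: (normc _) (r) (k) => nn rr kk; clear; lra.
have -> : toeplitz a M - l%:M = toeplitz b M - (l - mu)%:M.
  by rewrite -toeplitz_shifted raddfB /= opprB addrA subrK.
apply: mx_below_sub_scalar; apply/mx_below_toeplitz => x; exact: MB.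
Qed.

(** The slack [d] accommodates the enlarged level [eps + eps_block] of the
    block inclusion sets. *)
Lemma sections_upper a w eps eta : banded w a -> 0 <= eps -> 0 < eta ->
  exists2 d, 0 < d & exists M0, forall M, (M0 <= M)%N -> forall e l, e <= eps + d ->
    mx_pspec e (toeplitz a M) l ->
    exists2 mu, l2_pspec eps (toeplitz_op a w) mu & normc (l - mu) < eta.
Proof.
move=> aw e0 t0.
pose Q n l := forall M, (n <= M)%N -> (0 < M)%N ->
  mx_pspec (eps + n.+1%:R^-1) (toeplitz a M) l ->
  exists2 mu, l2_pspec eps (toeplitz_op a w) mu & normc (l - mu) < eta.
have [mu|n0 H] := @locally_uniform Q _ (band_sum w a + (eps + 1)).
  have [muS|muS] := pselect (l2_pspec eps (toeplitz_op a w) mu).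
    by exists eta => //; exists 0%N => n _ l lmu M _ _ _; exists mu.
  have [r r0 [M0 MP]] := resolvent_section_stable aw e0 muS.
  exists r => //; exists (maxn M0 (Num.bound r^-1)) => n; rewrite geq_max => /andP[M0n rn].
  move=> l lmu M nM Mp lS; exfalso.
  apply: (MP M _ Mp l lmu); first exact: leq_trans nM.
  apply: mx_pspec_mono lS; rewrite lerD2l -[leRHS]invrK lef_pV2 ?posrE ?invr_gt0//.
  apply: (@le_trans _ _ (Num.bound r^-1)%:R); first by rewrite ltW// archi_boundP// invr_ge0 ltW.
  by rewrite ler_nat ltnW.
(* The threshold [n0] also fixes the slack, through [Q]. *)
exists n0.+1%:R^-1; first by rewrite invr_gt0.
exists n0.+1 => M n0M e l ee lS.
have lS' := mx_pspec_mono ee lS; have M0 : (0 < M)%N by exact: leq_trans n0M.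
apply: (H n0 (leqnn _) l _ M) => //; last exact: ltnW.
apply: (mx_pspec_le aw M0 _ _ (e := eps + 1)); first by rewrite addr_ge0.
by apply: mx_pspec_mono lS'; rewrite lerD2l invf_le1// ler1n.
Qed.

(** The only property of the sections that distinguishes the admissible values
    of [eps]: it excludes that the level [eps] is reached by the operator at
    [l] while being missed by the sections on a whole disc around [l]. *)
Definition section_gap a eps := forall l eta, 0 < eta ->
  exists2 k, eps < k & forall M, (0 < M)%N ->
    (forall l', normc (l' - l) < eta -> ~ mx_pspec eps (toeplitz a M) l') ->
    mx_below (toeplitz a M - l%:M) k.

Lemma section_gap_pos a w eps : banded w a -> 0 < eps -> section_gap a eps.
Proof.
move=> aw e0 l eta t0.
have c0 : 0 < band_sum w (shifted a l) + 1 by rewrite ltr_wpDl ?band_sum_ge0.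
have [k ek H] := resolvent_growth e0 t0 c0; exists k => // M M0 disj.
apply: H => [x|z zt].
  apply: (@le_trans _ _ (band_sum w (shifted a l) * norm2 x)); last first.
    by rewrite ler_wpM2r ?norm2_ge0// lerDl.
  rewrite toeplitz_shifted; apply: mulmx_schur; last exact: band_sum_ge0.
    move=> i; under eq_bigr do rewrite mxE.
    apply: (sum_band_le (g := fun j : 'I_M => i%:Z - j%:Z)); last exact: banded_shifted.
    by move=> j k' jk; apply: val_inj => /=; lia.
  move=> i; under eq_bigr do rewrite mxE.
  apply: (sum_band_le (g := fun j : 'I_M => j%:Z - i%:Z)); last exact: banded_shifted.
  by move=> j k' jk; apply: val_inj => /=; lia.
have [|k' ek' Hk] := (not_mx_pspecP (toeplitz a M) (l + z) M0 (ltW e0)).1.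
  by apply: disj; rewrite addrAC subrr add0r.
rewrite -addrA -opprD -raddfD /=; exact: mx_below_le (ltW ek') Hk.
Qed.

Lemma section_gap_hermitian a : (forall j, a (- j) = (a j)^*) -> section_gap a 0.
Proof.
move=> aH l eta t0; exists eta => // M M0 disj.
apply: normal_below => [||z /disj]; first exact: ltW.
  have At : map_mx Num.conj (toeplitz a M)^T = toeplitz a M.
    by apply/matrixP => i j; rewrite !mxE; have := aH (j%:Z - i%:Z); rewrite opprB => ->.
  by apply/normalmxP; rewrite At.
by rewrite mx_pspec0E// /mx_spec /= => /negP; rewrite negbK.
Qed.

(** If infinitely many sections missed a disc around [l], they would share a
    lower bound larger than [eps], and so would the operator. *)
Lemma sections_lower1 a w eps eta l : banded w a -> 0 <= eps -> section_gap a eps ->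
  0 < eta -> l2_pspec eps (toeplitz_op a w) l ->
  exists M0, forall M, (M0 <= M)%N ->
    exists2 l', mx_pspec eps (toeplitz a M) l' & normc (l' - l) < eta.
Proof.
move=> aw e0 gap t0; rewrite /l2_pspec /= toeplitz_op_shifted => lS.
have [k ek H] := gap l eta t0.
apply: contrapT => nex.
suff : k <= l2_invnormV (toeplitz_op (shifted a l) w).
  by move=> /(lt_le_trans ek)/lt_le_trans/(_ lS); rewrite ltxx.
apply: op_invnormV_ge; [exact: banded_shifted|exact: le_lt_trans ek|].
move=> M0; apply: contrapT => noM; apply: nex; exists M0.+1 => M M0M.
apply: contrapT => nol; apply: noM; exists M; first exact: ltnW.
apply/mx_below_toeplitz; rewrite -toeplitz_shifted; apply: H; first exact: leq_trans M0M.
by move=> l' l't l'S; apply: nol; exists l'.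
Qed.

Lemma sections_lower a w eps eta : banded w a -> 0 <= eps -> section_gap a eps ->
  0 < eta ->
  exists M0, forall M, (M0 <= M)%N -> forall l, l2_pspec eps (toeplitz_op a w) l ->
    exists2 l', mx_pspec eps (toeplitz a M) l' & normc (l' - l) < eta.
Proof.
move=> aw e0 gap t0.
pose Q n l := l2_pspec eps (toeplitz_op a w) l -> forall M, (n <= M)%N ->
  exists2 l', mx_pspec eps (toeplitz a M) l' & normc (l' - l) < eta.
have t3 : 0 < eta / 3 by rewrite divr_gt0.
have [mu|n0 H] := @locally_uniform Q _ (band_sum w a + eps + 1).
  have [[l0 l0S l0mu]|none] := pselect (exists2 l0,
    l2_pspec eps (toeplitz_op a w) l0 & normc (l0 - mu) < eta / 3).
    have [M0 MP] := sections_lower1 aw e0 gap t3 l0S.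
    exists (eta / 3) => //; exists M0 => n M0n l lmu lS M nM.
    have [l' l'S l'l0] := MP M (leq_trans M0n nM); exists l' => //.
    have -> : l' - l = (l' - l0) + (l0 - mu) + (mu - l).
      by rewrite -addrA !subrKA.
    apply: le_lt_trans (le_normcD _ _) _.
    apply: (@lt_trans _ _ (normc (l' - l0 + (l0 - mu)) + eta / 3)).
      by rewrite ltrD2l normc_distC.
    rewrite [ltRHS](_ : eta = eta / 3 + eta / 3 + eta / 3); last by field.
    by rewrite ltrD2r; apply: le_lt_trans (le_normcD _ _) _; exact: ltrD.
  exists (eta / 3) => //; exists 0%N => n _ l lmu lS.
  by case: none; exists l.
exists n0 => M n0M l lS; apply: (H n0 _ l) => //.
have [M1 MP] := sections_lower1 aw e0 gap ltr01 lS.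
have [l' l'S l'l] := MP M1.+1 (leqnSn _).
rewrite -[l](subKr l'); apply: le_trans (le_normcD _ _) _.
rewrite normcN; apply: lerD (ltW l'l).
exact: mx_pspec_le aw _ e0 l'S.
Qed.

End SpectralLimits.

(** * Hausdorff distance and block inclusion sets *)

Section HausdorffCloseness.
Context {R : realType}.
Local Notation C := R[i].
Implicit Types S T U : set C.

Definition hclose (eta : R) S T :=
  (forall s, S s -> exists2 t, T t & normc (s - t) < eta) /\
  (forall t, T t -> exists2 s, S s & normc (t - s) < eta).

Lemma hclose_sym eta S T : hclose eta S T -> hclose eta T S.
Proof. by case. Qed.

Lemma hclose_trans e1 e2 S T U :
  hclose e1 S T -> hclose e2 T U -> hclose (e1 + e2) S U.
Proof.
have tri (x y z : C) : normc (x - y) < e1 -> normc (y - z) < e2 ->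
    normc (x - z) < e1 + e2.
  move=> xy yz; rewrite -(subrKA y); exact: le_lt_trans (le_normcD _ _) (ltrD xy yz).
move=> [ST TS] [TU UT]; split=> [s /ST[t /TU[u uU tu] st]|u /UT[t /TS[s sS ts] ut]].
  by exists u => //; exact: tri st tu.
exists s => //; rewrite normc_distC; apply: tri ; rewrite normc_distC; [exact: ts|exact: ut].
Qed.

Lemma hausdorff_le eta S T : hclose eta S T -> (hausdorff S T <= eta%:E)%E.
Proof.
have half (A B : set C) : (forall s, A s -> exists2 t, B t & normc (s - t) < eta) ->
    (ereal_sup [set cdist s B | s in A] <= eta%:E)%E.
  move=> AB; apply: ge_ereal_sup => _ [s /AB[t Bt st] <-].
  apply: ge_ereal_inf; exists (normc (s - t))%:E; first by exists t.
  by rewrite lee_fin ltW.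
by move=> [ST TS]; rewrite /hausdorff ge_max !half.
Qed.

(** Nonemptiness matters: the distance between two empty sets is [-oo]. *)
Lemma hausdorff_ge0 S T : S !=set0 -> (0 <= hausdorff S T)%E.
Proof.
move=> [s Ss]; rewrite /hausdorff le_max; apply/orP; left.
apply: le_ereal_sup_tmp; exists (cdist s T); first by exists s.
by apply: le_ereal_inf_tmp => _ [t Tt <-]; rewrite lee_fin normc_ge0.
Qed.

End HausdorffCloseness.

Section BlockData.
Context {R : realType}.
Local Notation C := R[i].
Implicit Types (a : int -> C).

Lemma mxopnorm_submxblock_le a w N (m : 'I_N -> nat) i j : banded w a ->
  mxopnorm (submxblock (toeplitz a (\sum_i m i)) i j) <= band_sum w a.
Proof.
move=> aw; apply: mxopnorm_le; first exact: band_sum_ge0.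
have Rinj k : injective (@tagnat.Rank _ m k).
  by move=> u v uv; apply/eqP; rewrite eq_le -!tagnat.le_Rank uv lexx.
have E k l : normc (submxblock (toeplitz a (\sum_i m i)) i j k l) =
    normc (a ((tagnat.Rank i k)%:Z - (tagnat.Rank j l)%:Z)) by rewrite !mxE.
apply: mulmx_schur; last exact: band_sum_ge0.
  move=> k; rewrite (eq_bigr _ (fun l _ => E k l)).
  apply: (sum_band_le (g := fun l => (tagnat.Rank i k)%:Z - (tagnat.Rank j l)%:Z)) => //.
  by move=> u v /addrI/oppr_inj[] uv; apply: Rinj; exact: val_inj.
move=> l; rewrite (eq_bigr _ (fun k _ => E k l)).
apply: (sum_band_le (g := fun k => (tagnat.Rank i k)%:Z - (tagnat.Rank j l)%:Z)) => //.
by move=> u v /addIr[] uv; apply: Rinj; exact: val_inj.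
Qed.

Lemma rLU_bounds a w N (m : 'I_N -> nat) : banded w a ->
  0 <= rLU (toeplitz a (\sum_i m i)) <= 2 * band_sum w a.
Proof.
move=> aw; have b0 := band_sum_ge0 w a.
have bnd (P : pred ('I_N * 'I_N)) (F : 'I_N * 'I_N -> R) :
    (forall p, 0 <= F p <= band_sum w a) ->
    0 <= \big[Num.max/0]_(p | P p) F p <= band_sum w a.
  move=> Fb; elim/big_ind: _ => [|x y /andP[x0 xb] /andP[y0 yb]|p _]; last exact: Fb.
    by rewrite lexx.
  by rewrite le_max x0 ge_max xb.
have Fb (p : 'I_N * 'I_N) :
    0 <= mxopnorm (submxblock (toeplitz a (\sum_i m i)) p.1 p.2) <= band_sum w a.
  by rewrite mxopnorm_ge0 mxopnorm_submxblock_le.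
have /andP[l0 lb] := bnd (fun p => p.1 == p.2.+1 :> nat) _ Fb.
have /andP[u0 ub] := bnd (fun p => p.2 == p.1.+1 :> nat) _ Fb.
by rewrite /rLU /rL /rU addr_ge0//= mulr_natl mulr2n lerD.
Qed.

(** The default value [0] of [theta] satisfies the bounds that the interval in
    its definition gives. *)
Lemma theta_bounds N (m : 'I_N -> nat) (A : 'M[C]_(\sum_i m i)) n :
  0 <= theta A n <= pi / (n%:R + 2).
Proof.
rewrite /theta; case: xgetP => [t _ [/andP[t1 t2] _]|_].
  by rewrite t2 andbT; apply: le_trans t1; rewrite divr_ge0 ?pi_ge0.
by rewrite lexx divr_ge0 ?pi_ge0.
Qed.

Lemma eps_block_small a w (d : R) : banded w a -> 0 < d ->
  exists n0, forall n N (m : 'I_N -> nat), (n0 <= n)%N ->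
    0 <= eps_block (toeplitz a (\sum_i m i)) n <= d.
Proof.
move=> aw d0; set c := 4 * band_sum w a + 1.
have c0 : 0 < c by rewrite ltr_wpDl// mulr_ge0 ?band_sum_ge0.
have /cvgrPdist_lt/(_ (d / c)) := @continuous_sin R 0.
rewrite divr_gt0// => /(_ isT)[r /= r0 sin_small].
exists (Num.bound (pi / r)) => n N m n0n.
rewrite /eps_block; case: ifP => [_|_]; first by rewrite lexx ltW.
have /andP[t0 t1] := theta_bounds (toeplitz a (\sum_i m i)) n.
set t := theta _ _ in t0 t1 *.
have n2 : 0 < n%:R + 2 :> R by rewrite ltr_wpDl.
have t2 : t / 2 <= t by rewrite ler_pdivrMr// ler_peMr// ler1n.
have tpi : t <= pi.
  apply: le_trans t1 _; rewrite ler_pdivrMr// ler_peMr ?pi_ge0//.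
  by rewrite (@le_trans _ _ 2) ?ler1n// lerDr.
have tr : t < r.
  apply: le_lt_trans t1 _; rewrite ltr_pdivrMr// mulrC -ltr_pdivrMr//.
  apply: lt_le_trans (archi_boundP _) _; first by rewrite divr_ge0 ?pi_ge0 ?ltW.
  by apply: (@le_trans _ _ n%:R); rewrite ?ler_nat// lerDl.
have s0 : 0 <= sin (t / 2) by rewrite sin_ge0_pi// divr_ge0//= (le_trans t2).
have sd : sin (t / 2) <= d / c.
  have := sin_small (t / 2); rewrite sin0 !sub0r !normrN !ger0_norm ?divr_ge0//.
  move=> h; apply/ltW/h; rewrite /= sub0r normrN ger0_norm ?divr_ge0//.
  exact: le_lt_trans t2 tr.
have /andP[q0 qb] := rLU_bounds m aw.
rewrite !mulr_ge0//=.
apply: (@le_trans _ _ (c * (d / c))); last by rewrite mulrCA divff ?mulr1// gt_eqF.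
apply: ler_pM => //; first by rewrite mulr_ge0.
rewrite /c; have : 2 * rLU (toeplitz a (\sum_i m i)) <= 2 * (2 * band_sum w a) by rewrite ler_pM2l.
by move=> /le_trans; apply; rewrite mulrA -natrM lerDl.
Qed.

Lemma Msize_ge N (m : 'I_N -> nat) n k : (forall i, (0 < m i)%N) ->
  (k + n <= N)%N -> (n <= Msize m n k)%N.
Proof.
move=> m0 kn; have ltN (i : 'I_n) : (k + i < N)%N.
  by apply: leq_trans kn; rewrite ltn_add2l.
pose f (i : 'I_n) := Ordinal (ltN i).
have fI : injective f by move=> i j /(congr1 val)/= /addnI/val_inj.
rewrite -{1}[n]card_ord -(card_codom fI).
have -> : Msize m n k = (\sum_(i < N | (k <= i < k + n)%N) m i)%N by [].
apply: (@leq_trans (\sum_(i < N | (k <= i < k + n)%N) 1)%N); last first.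
  by apply: leq_sum => i _; exact: m0.
rewrite sum1_card; apply: subset_leq_card; apply/fintype.subsetP => _ /codomP[i ->].
by rewrite unfold_in /= leq_addr ltn_add2l ltn_ord.
Qed.

Lemma sum_block_sizes_ge N (m : 'I_N -> nat) : (forall i, (0 < m i)%N) ->
  (N <= \sum_i m i)%N.
Proof. by move=> m0; rewrite -{1}[N]card_ord -sum1_card leq_sum. Qed.

End BlockData.

Section MainLimits.
Context {R : realType}.
Local Notation C := R[i].
Variables (a : int -> C) (w : nat) (eps : R).
Hypotheses (aw : banded w a) (eps_ge0 : 0 <= eps) (gap : section_gap a eps).

Lemma sections_close eta : 0 < eta -> exists M0, forall M, (M0 <= M)%N ->
  hclose eta (mx_pspec eps (toeplitz a M)) (l2_pspec eps (toeplitz_op a w)).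
Proof.
move=> t0; have [d d0 [M1 up]] := sections_upper aw eps_ge0 t0.
have [M2 low] := sections_lower aw eps_ge0 gap t0.
exists (maxn M1 M2) => M; rewrite geq_max => /andP[M1M M2M]; split.
  by move=> l lS; apply: (up M M1M eps l) lS; rewrite lerDl ltW.
by move=> l /(low M M2M)[l' l'S ll]; exists l' => //; rewrite normc_distC.
Qed.

(** Upwards, [Sigma] lies in [sigma_hat], whose matrices all have size at least
    [n].  Downwards, the single leading section of size [Msize m n 0] already
    approximates the limit and lies in both [sigma] and [sigma_hat]. *)
Lemma Sigma_close eta : 0 < eta -> exists n0, forall n N (m : 'I_N -> nat),
  admissible a w n m -> (n0 <= n)%N ->
  hclose eta (Sigma a m n eps) (l2_pspec eps (toeplitz_op a w)).
Proof.
move=> t0; have [d d0 [M1 up]] := sections_upper aw eps_ge0 t0.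
have [M2 low] := sections_lower aw eps_ge0 gap t0.
have [n1 small] := eps_block_small aw d0.
exists (maxn (maxn M1 M2) (n1 + 3)) => n N m [N1 /andP[n0 nN] m0 _].
rewrite !geq_max -andbA => /and3P[M1n M2n n1n].
have n2 : (2 < n)%N by lia.
rewrite /Sigma leqNgt n2 /=; split=> l.
  move=> [_ [k /= kN lS]].
  have nM : (n <= Msize m n k)%N by apply: Msize_ge => //; lia.
  apply: (up _ (leq_trans M1n nM) _ _ _ lS).
  by rewrite lerD2l; have /andP[] := small (n - 2)%N N m ltac:(lia).
have nM : (n <= Msize m n 0)%N by apply: Msize_ge => //; lia.
move=> /(low _ (leq_trans M2n nM))[l' l'S ll].
exists l'; last by rewrite normc_distC.
split.
  left; exists 0%N => //=; apply: mx_pspec_mono l'S; rewrite lerDl.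
  by have /andP[] := small n N m ltac:(lia).
exists 0%N => //=; apply: mx_pspec_mono l'S; rewrite lerDl.
by have /andP[] := small (n - 2)%N N m ltac:(lia).
Qed.

Lemma Sigma_sections_close eta : 0 < eta -> exists n0, forall n N (m : 'I_N -> nat),
  admissible a w n m -> (n0 <= n)%N ->
  hclose eta (Sigma a m n eps) (mx_pspec eps (toeplitz a (\sum_i m i))).
Proof.
move=> t0; have t2 : 0 < eta / 2 by rewrite divr_gt0.
have [n1 H1] := Sigma_close t2; have [M1 H2] := sections_close t2.
exists (maxn n1 M1) => n N m adm; rewrite geq_max => /andP[n1n M1n].
rewrite (splitr eta); apply: hclose_trans (H1 n N m adm n1n) _; apply: hclose_sym.
apply: H2; case: adm => _ /andP[_ nN] m0 _.
exact: leq_trans M1n (leq_trans (ltnW nN) (sum_block_sizes_ge m0)).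
Qed.

Lemma hclose_admissible_cvg0 (S : forall N, ('I_N -> nat) -> nat -> set C)
    (T : forall N, ('I_N -> nat) -> set C) :
  (forall eta, 0 < eta -> exists n0, forall n N (m : 'I_N -> nat),
    admissible a w n m -> (n0 <= n)%N -> hclose eta (S N m n) (T N m)) ->
  admissible_cvg0 a w (fun n N m => hausdorff (S N m n) (T N m)).
Proof.
move=> close d d0; have d2 : 0 < d / 2 by rewrite divr_gt0.
have [n0 H] := close _ d2; exists n0 => n N m adm n0n.
apply: le_lt_trans (hausdorff_le (H n N m adm n0n)) _.
by rewrite lte_fin ltr_pdivrMr// ltr_pMr// ltr1n.
Qed.

Lemma hausdorff_sections_cvg0 :
  (fun M : nat => hausdorff (mx_pspec eps (toeplitz a M))
                            (l2_pspec eps (toeplitz_op a w))) @ \oo --> 0%:E.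
Proof.
have [M1 fin] := sections_close ltr01.
have ge0 M : (0 < M)%N -> (0 <= hausdorff (mx_pspec eps (toeplitz a M))
                                          (l2_pspec eps (toeplitz_op a w)))%E.
  move=> M0; apply: hausdorff_ge0.
  by have [l lS] := mx_spec_neq0 (toeplitz a M) M0; exists l; exact: mx_spec_pspec lS.
have finite M eta : (0 < M)%N -> hclose eta (mx_pspec eps (toeplitz a M))
      (l2_pspec eps (toeplitz_op a w)) ->
    hausdorff (mx_pspec eps (toeplitz a M)) (l2_pspec eps (toeplitz_op a w))
      \is a fin_num.
  move=> M0 /hausdorff_le h; rewrite ge0_fin_numE ?ge0//.
  by apply: le_lt_trans h _; rewrite ltry.
apply/fine_cvgP; split.
  by exists M1.+1 => // M /= M1M; apply: (finite M 1); [exact: leq_trans M1M|apply/fin/ltnW].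
apply/cvgrPdist_le => e e0; have [M2 H] := sections_close e0.
exists M2.+1 => // M /= M2M; have M0 : (0 < M)%N by exact: leq_trans M2M.
have close := H M (ltnW M2M).
rewrite sub0r normrN ger0_norm ?fine_ge0 ?ge0//.
by rewrite -lee_fin fineK ?(finite M e)// hausdorff_le.
Qed.

End MainLimits.

Theorem theorem5p5 (R : realType) (w : nat) (a : int -> R[i])
    (w_gt0 : (0 < w)%N)
    (a_band : forall j : int, (w < `|j|)%N -> a j = 0) :
  (forall eps : R,
     0 < eps \/ ((forall j : int, a (- j) = (a j)^*) /\ eps = 0) ->
     [/\ (fun M : nat => hausdorff (mx_pspec eps (toeplitz a M))
                                   (l2_pspec eps (toeplitz_op a w)))
           @ \oo --> 0%:E,
         admissible_cvg0 a w (fun n N m =>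
           hausdorff (Sigma a m n eps) (l2_pspec eps (toeplitz_op a w))) &
         admissible_cvg0 a w (fun n N m =>
           hausdorff (Sigma a m n eps)
                     (mx_pspec eps (toeplitz a (\sum_i m i))))])
  /\ ((forall j : int, a (- j) = (a j)^*) ->
      admissible_cvg0 a w (fun n N m =>
        hausdorff (Sigma a m n 0) (mx_spec (toeplitz a (\sum_i m i))))).
Proof.
have limits eps : 0 <= eps -> section_gap a eps ->
    [/\ (fun M : nat => hausdorff (mx_pspec eps (toeplitz a M))
                                   (l2_pspec eps (toeplitz_op a w)))
           @ \oo --> 0%:E,
         admissible_cvg0 a w (fun n N m =>
           hausdorff (Sigma a m n eps) (l2_pspec eps (toeplitz_op a w))) &
         admissible_cvg0 a w (fun n N m =>
           hausdorff (Sigma a m n eps)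
                     (mx_pspec eps (toeplitz a (\sum_i m i))))].
  move=> e0 gap; split.
  - exact: hausdorff_sections_cvg0.
  - apply: (@hclose_admissible_cvg0 _ _ _ (fun N m n => Sigma a m n eps)
      (fun N m => l2_pspec eps (toeplitz_op a w))).
    exact: Sigma_close.
  - apply: (@hclose_admissible_cvg0 _ _ _ (fun N m n => Sigma a m n eps)
      (fun N m => mx_pspec eps (toeplitz a (\sum_i m i)))).
    exact: Sigma_sections_close.
split=> [eps [e0|[aH ->]]|aH].
- by apply: limits; [exact: ltW|exact: (section_gap_pos a_band e0)].
- by apply: limits => //; exact: section_gap_hermitian.
have [_ _ lim] := limits 0 (lexx 0) (section_gap_hermitian aH).
move=> d d0; have [n0 H] := lim d d0; exists n0 => n N m adm n0n.
rewrite -mx_pspec0E; first exact: H.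
case: adm => N1 _ m0 _; exact: leq_trans (ltnW N1) (sum_block_sizes_ge m0).
Qed.
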